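(* Let $k$ be an algebraically closed field of characteristic zero or greater than $5$, and let $P=k_{dp}[x_1,x_2]$. For a general polynomial $f\in P_{\le 5}$ of degree five, the algebra $\operatorname{Apolar}(f)$ is canonically graded. That is, there is a non-empty Zariski open subset $U$ of the affine space $P_{\le 5}$ such that every $f\in U$ has degree five and $\operatorname{Apolar}(f)$ is isomorphic to its associated graded algebra $\operatorname{gr}\operatorname{Apolar}(f)$.
   Context: Let $S=k[[\alpha_1,\alpha_2]]$. $P=k_{dp}[x_1,x_2]$ is the divided power ring, with $k$-basis the monomials $\mathbf x^{[\mathbf a]}$, $\mathbf a\in\mathbb N_0^2$ (of degree $\sum a_i$), $P_{\le m}$ is the span of those of degree at most $m$, and $S$ acts on $P$ by contraction: $\alpha^{\mathbf a}\lrcorner \mathbf x^{[\mathbf b]}=\mathbf x^{[\mathbf b-\mathbf a]}$ if $\mathbf b\ge\mathbf a$ coordinatewise and $0$ otherwise. For $f\in P$, $\operatorname{Apolar}(f)=S/\operatorname{Ann}(f)$ with $\operatorname{Ann}(f)=\{\sigma\in S:\sigma\lrcorner f=0\}$. For a local algebra $(A,\mathfrak m_A)$, $\operatorname{gr}A=\bigoplus_{i}\mathfrak m_A^i/\mathfrak m_A^{i+1}$. *)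

(* Defs.v *)
(* MathComp, with mathcomp-classical for choice on power series and multinomials
   for multi-indices. *)
From HB Require Import structures.
From mathcomp Require Import all_boot all_algebra.
From mathcomp Require Import boolp.
From mathcomp Require Import freeg mpoly.

Set Implicit Arguments.
Unset Strict Implicit.
Unset Printing Implicit Defensive.

Import GRing.Theory.

Local Open Scope ring_scope.
Local Open Scope quotient_scope.

(* MathComp's [algType] excludes the zero ring, but [Apolar 0] is zero; hence
   commutative algebras are described here by their structure map. *)
HB.mixin Record hasAlgebraMap (k : comNzRingType) A of GRing.ComPzRing A := {
  algmap : k -> A;
  algmap_zmod_subproof : zmod_morphism algmap;
  algmap_monoid_subproof : monoid_morphism algmap
}.

#[short(type="pzComAlgType")]
HB.structure Definition PzComAlg (k : comNzRingType) :=
  {A of GRing.ComPzRing A & hasAlgebraMap k A}.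

HB.instance Definition _ (k : comNzRingType) (A : pzComAlgType k) :=
  GRing.isZmodMorphism.Build k A (@algmap k A) algmap_zmod_subproof.
HB.instance Definition _ (k : comNzRingType) (A : pzComAlgType k) :=
  GRing.isMonoidMorphism.Build k A (@algmap k A) algmap_monoid_subproof.

Definition alg_isomorphic (k : comNzRingType) (A B : pzComAlgType k) : Prop :=
  exists2 phi : {rmorphism A -> B},
    bijective phi & forall c : k, phi (algmap c) = algmap c.

Section PowerSeries.

Variables (n : nat) (k : comNzRingType).

(* k[[alpha_1, ..., alpha_n]]: [s a] is the coefficient of alpha^a. *)
Definition mseries := 'X_{1..n} -> k.

HB.instance Definition _ := gen_eqMixin mseries.
HB.instance Definition _ := gen_choiceMixin mseries.

Implicit Types s t u : mseries.

Definition mseries0 : mseries := fun=> 0.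
Definition mseriesN s : mseries := fun a => - s a.
Definition mseriesD s t : mseries := fun a => s a + t a.

Fact mseriesDA : associative mseriesD.
Proof. by move=> s t u; apply: funext => a; apply: addrA. Qed.
Fact mseriesDC : commutative mseriesD.
Proof. by move=> s t; apply: funext => a; apply: addrC. Qed.
Fact mseries0D : left_id mseries0 mseriesD.
Proof. by move=> s; apply: funext => a; apply: add0r. Qed.
Fact mseriesND : left_inverse mseries0 mseriesN mseriesD.
Proof. by move=> s; apply: funext => a; apply: addNr. Qed.

HB.instance Definition _ := GRing.isZmodule.Build mseries
  mseriesDA mseriesDC mseries0D mseriesND.

Definition mseriesC (c : k) : mseries := fun a => if a == 0%MM then c else 0.

(* The bound on the degrees only makes the range of summation a finite type. *)
Definition mseriesM s t : mseries := fun c =>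
  \sum_(ab : 'X_{1..n < (mdeg c).+1, (mdeg c).+1} | c == (ab.1 + ab.2)%MM)
     s ab.1 * t ab.2.

Definition mseries_trunc d s : {mpoly k[n]} :=
  \sum_(a : 'X_{1..n < d}) s a *: 'X_[a].

Lemma mcoeff_trunc d s a : (mdeg a < d)%N -> (mseries_trunc d s)@_a = s a.
Proof. exact: mcoeff_mpoly. Qed.

Lemma mseriesM_mcoeff s t (p q : {mpoly k[n]}) c :
    (forall a, (mdeg a <= mdeg c)%N -> p@_a = s a) ->
    (forall a, (mdeg a <= mdeg c)%N -> q@_a = t a) ->
  mseriesM s t c = (p * q)@_c.
Proof.
move=> ps qt; rewrite mcoeffM; apply: eq_bigr => -[[a /= la] [b /= lb]] _.
by rewrite ps ?qt.
Qed.

Lemma mseriesM_trunc d s t c : (mdeg c < d)%N ->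
  mseriesM s t c = (mseries_trunc d s * mseries_trunc d t)@_c.
Proof.
by move=> cd; apply: mseriesM_mcoeff => a ac;
  apply: mcoeff_trunc (leq_ltn_trans ac cd).
Qed.

Fact mseriesMA : associative mseriesM.
Proof.
move=> s t u; apply: funext => c; set T := mseries_trunc (mdeg c).+1.
rewrite (@mseriesM_mcoeff _ _ (T s) (T t * T u)); last 2 first.
- by move=> a ac; apply: mcoeff_trunc.
- by move=> a ac; rewrite -mseriesM_trunc.
rewrite (@mseriesM_mcoeff _ _ (T s * T t) (T u)) ?mulrA //.
- by move=> a ac; rewrite -mseriesM_trunc.
- by move=> a ac; apply: mcoeff_trunc.
Qed.

Fact mseriesMC : commutative mseriesM.
Proof.
by move=> s t; apply: funext => c; rewrite !(mseriesM_trunc _ _ (ltnSn _)) mulrC.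
Qed.

Fact mseries1M : left_id (mseriesC 1) mseriesM.
Proof.
move=> s; apply: funext => c.
rewrite (@mseriesM_mcoeff _ _ 1 (mseries_trunc (mdeg c).+1 s)).
- by rewrite mul1r mcoeff_trunc.
- by move=> a _; rewrite mcoeff1 /mseriesC; case: eqP.
- by move=> a ac; apply: mcoeff_trunc.
Qed.

Fact mseriesMDl : left_distributive mseriesM mseriesD.
Proof.
move=> s t u; apply: funext => c; rewrite /mseriesM /mseriesD -big_split /=.
by apply: eq_bigr => ab _; rewrite mulrDl.
Qed.

Fact mseries1_neq0 : mseriesC 1 != 0.
Proof.
apply/eqP => /(congr1 (fun s : mseries => s 0%MM)); rewrite /mseriesC eqxx.
by move/eqP; rewrite oner_eq0.
Qed.

HB.instance Definition _ := GRing.Zmodule_isComNzRing.Build mseries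
  mseriesMA mseriesMC mseries1M mseriesMDl mseries1_neq0.

Fact mseriesC_zmod : zmod_morphism mseriesC.
Proof.
move=> c d; apply: funext => a.
have -> : (mseriesC c - mseriesC d) a = mseriesC c a - mseriesC d a by [].
by rewrite /mseriesC; case: eqP; rewrite ?subr0.
Qed.

Fact mseriesC_monoid : monoid_morphism mseriesC.
Proof.
split=> // c d; apply: funext => a.
have -> : (mseriesC c * mseriesC d) a = mseriesM (mseriesC c) (mseriesC d) a by [].
rewrite (@mseriesM_mcoeff _ _ c%:MP d%:MP).
- by rewrite -mpolyCM mcoeffC /mseriesC; case: eqP; rewrite ?mulr1 ?mulr0.
- by move=> b _; rewrite mcoeffC /mseriesC; case: eqP; rewrite ?mulr1 ?mulr0.
- by move=> b _; rewrite mcoeffC /mseriesC; case: eqP; rewrite ?mulr1 ?mulr0.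
Qed.

HB.instance Definition _ :=
  hasAlgebraMap.Build k mseries mseriesC_zmod mseriesC_monoid.

End PowerSeries.

Section Apolar.

Variables (n : nat) (k : fieldType).

(* The divided power ring k_dp[x_1, ..., x_n] as a vector space: [<< a >>] is
   the basis monomial x^[a] and [coeff a f] its coefficient in f.  The product
   of divided powers plays no role in the S-module structure. *)
Definition dpoly := {freeg 'X_{1..n} / k}.
HB.instance Definition _ := GRing.Lmodule.on dpoly.

Local Notation S := (mseries n k).

Implicit Types (s t : S) (f g : dpoly).

Definition contract_mon s (b : 'X_{1..n}) : dpoly :=
  \sum_(a : 'X_{1..n < (mdeg b).+1} | (a <= b)%MM) << s a *g (b - a)%MM >>.

Definition contract s f : dpoly := fglift (contract_mon s) f.

Lemma coeff_contract_mon s b c :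
  coeff c (contract_mon s b) = if (c <= b)%MM then s (b - c)%MM else 0.
Proof.
rewrite /contract_mon raddf_sum /=; case: ifP => cb.
  have lt : (mdeg (b - c) < (mdeg b).+1)%N by rewrite ltnS mdegB.
  rewrite (bigD1 (BMultinom lt)) /=; last exact: lem_subr.
  rewrite coeffU submBA // addmC addmK eqxx mulr1 big1 ?addr0 // => a /andP[ab ne].
  rewrite coeffU; case: eqP => [e|_]; last by rewrite mulr0.
  case/eqP: ne; apply: val_inj => /=.
  by rewrite -e submBA // addmC addmK.
rewrite big1 // => a ab; rewrite coeffU; case: eqP => [e|_]; last by rewrite mulr0.
by move: cb; rewrite -e lem_subr.
Qed.

Fact contract_zmod s : zmod_morphism (contract s).
Proof. exact: lift_is_additive. Qed.

HB.instance Definition _ s :=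
  GRing.isZmodMorphism.Build dpoly dpoly (contract s) (contract_zmod s).

Lemma contractU s c b : contract s << c *g b >> = c *: contract_mon s b.
Proof. exact: liftU. Qed.

Lemma contractE s f : contract s f = \sum_(b <- dom f) coeff b f *: contract_mon s b.
Proof.
rewrite -{1}[f]freeg_sumE raddf_sum /=.
by apply: eq_bigr => b _; rewrite contractU.
Qed.

Lemma coeff_contract s f c :
  coeff c (contract s f) =
    \sum_(b <- dom f | (c <= b)%MM) coeff b f * s (b - c)%MM.
Proof.
rewrite contractE raddf_sum /= [RHS]big_mkcond /=; apply: eq_bigr => b _.
by rewrite coeffZ coeff_contract_mon; case: ifP; rewrite ?mulr0.
Qed.

Lemma dpolyP f g : (forall a, coeff a f = coeff a g) -> f = g.
Proof. by move=> fg; apply/eqP/freeg_eqP. Qed.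

Lemma contractBl s t f : contract (s - t) f = contract s f - contract t f.
Proof.
apply: dpolyP => c; rewrite coeffB !coeff_contract -sumrB.
by apply: eq_bigr => b _; rewrite -mulrBr.
Qed.

Lemma contract0l f : contract 0 f = 0.
Proof. by rewrite -(subrr 0) contractBl subrr. Qed.

Lemma mseriesM_lin s t c d : (mdeg c < d)%N ->
  (s * t) c = \sum_(a : 'X_{1..n < d} | (a <= c)%MM) s a * t (c - a)%MM.
Proof.
move=> cd; rewrite [LHS](mseriesM_trunc _ _ cd).
rewrite [LHS](mcoeff_poly_mul_lin _ _ cd); apply: eq_bigr => a ac.
by rewrite !mcoeff_trunc ?bmdeg // (leq_ltn_trans _ cd) // mdegB.
Qed.

Lemma contractM s t f : contract (s * t) f = contract s (contract t f).
Proof.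
rewrite [contract t f]contractE [LHS]contractE raddf_sum /=.
apply: eq_bigr => b _; apply: dpolyP => c.
rewrite coeffZ [in RHS]/contract_mon scaler_sumr [in RHS]raddf_sum [in RHS]raddf_sum /=.
pose F (a : 'X_{1..n}) := coeff b f *
  (t a * (if (c <= b - a)%MM then s (b - a - c)%MM else 0)).
rewrite [RHS](eq_bigr (fun a : 'X_{1..n < (mdeg b).+1} => F a)); last first.
  move=> a ab; have -> : coeff b f *: << t a *g (b - a)%MM >>
      = << coeff b f * t a *g (b - a)%MM >> :> dpoly.
    by apply: dpolyP => e; rewrite coeffZ !coeffU mulrA.
  by rewrite contractU coeffZ coeff_contract_mon -mulrA.
rewrite {}/F -mulr_sumr; congr (_ * _); rewrite coeff_contract_mon.
case: ifP => cb; last first.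
  rewrite big1 // => a ab; case: ifP => [cba|_]; last by rewrite mulr0.
  by rewrite (lepm_trans cba (lem_subr _ _)) in cb.
rewrite mulrC (@mseriesM_lin _ _ _ (mdeg b).+1) ?ltnS ?mdegB //.
rewrite [RHS](eq_bigr (fun a : 'X_{1..n < (mdeg b).+1} =>
  if (c <= b - a)%MM then t a * s (b - a - c)%MM else 0)); last first.
  by move=> a _; case: ifP; rewrite ?mulr0.
rewrite -big_mkcondr /=; apply: eq_big => [a|a _]; last by rewrite !submDA addmC.
have nat_le (x y z : nat) : (z <= y)%N -> (x <= y - z)%N = (x <= y)%N && (z <= y - x)%N.
  move=> zy; rewrite leq_subRL //; case: (leqP x y) => xy /=.
    by rewrite leq_subRL // addnC.
  by apply/negbTE; rewrite -ltnNge (leq_trans xy) ?leq_addl.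
apply/idP/andP => [/mnm_lepP abc|[/mnm_lepP ab /mnm_lepP cba]].
  by split; apply/mnm_lepP => i; move: (abc i);
    rewrite !mnmE (nat_le _ _ _ (mnm_lepP cb i)) => /andP[].
apply/mnm_lepP => i; rewrite mnmE nat_le; last exact/mnm_lepP.
by rewrite ab /=; move: (cba i); rewrite mnmE.
Qed.

Lemma contract1 f : contract 1 f = f.
Proof.
apply: dpolyP => c.
rewrite contractE raddf_sum /= -[in RHS](freeg_sumE f) raddf_sum /=.
apply: eq_bigr => b _; rewrite coeffZ coeffU coeff_contract_mon; congr (_ * _).
rewrite -[X in (if _ then X else _)]/(@mseriesC n k 1 (b - c)%MM) /mseriesC.
have [->|bc] := eqVneq b c; first by rewrite lepm_refl -{1}[c]add0m addmK eqxx.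
case: ifP => // cb; case: eqP => // bc0; case/eqP: bc.
by rewrite -(submK cb) bc0 add0m.
Qed.

Definition Ann f : {pred S} := fun s => contract s f == 0.

Fact Ann_zmod_closed f : zmod_closed (Ann f).
Proof.
split=> [|s t]; rewrite !unfold_in; first by rewrite contract0l.
by move=> /eqP sf /eqP tf; rewrite contractBl sf tf subr0.
Qed.

HB.instance Definition _ f := GRing.isZmodClosed.Build S (Ann f) (Ann_zmod_closed f).

Lemma Ann_mull f s t : t \in Ann f -> s * t \in Ann f.
Proof. by rewrite !unfold_in => /eqP tf; rewrite contractM tf raddf0. Qed.

(* [{ideal_quot _}] only carries a ring structure for proper ideals. *)
Definition Apolar f : Type := Quotient.quot (Ann f).

HB.instance Definition _ f := GRing.Zmodule.on (Apolar f).
HB.instance Definition _ f := Quotient.on (Apolar f).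

Section ApolarRing.

Variable f : dpoly.

Definition apolar_cls (s : S) : Apolar f := \pi s.

Lemma apolar_clsP s t : apolar_cls s = apolar_cls t <-> s - t \in Ann f.
Proof.
split=> [/eqP|st].
  by rewrite /apolar_cls => e; rewrite Quotient.idealrBE.
by apply/eqP; rewrite -Quotient.idealrBE.
Qed.

Lemma apolar_cls_ind (P : Apolar f -> Prop) :
  (forall s, P (apolar_cls s)) -> forall x, P x.
Proof. by move=> Pcls x; rewrite -[x]reprK; apply: Pcls. Qed.

Fact apolar_cls_zmod : zmod_morphism apolar_cls.
Proof. exact: raddfB. Qed.

Definition apolar1 : Apolar f := apolar_cls 1.
Definition apolarM (x y : Apolar f) : Apolar f := apolar_cls (repr x * repr y).

Lemma apolar_repr s : repr (apolar_cls s) - s \in Ann f.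
Proof. by apply/apolar_clsP; apply: reprK. Qed.

Lemma apolarME s t : apolarM (apolar_cls s) (apolar_cls t) = apolar_cls (s * t).
Proof.
apply/apolar_clsP; set s' := repr _; set t' := repr _.
have -> : s' * t' - s * t = s' * (t' - t) + t * (s' - s).
  by rewrite !mulrBr [t * s']mulrC [t * s]mulrC addrA subrK.
by apply: rpredD; apply: Ann_mull; apply: apolar_repr.
Qed.

Fact apolarMA : associative apolarM.
Proof.
elim/apolar_cls_ind=> s; elim/apolar_cls_ind=> t; elim/apolar_cls_ind=> u.
by rewrite !apolarME mulrA.
Qed.

Fact apolarMC : commutative apolarM.
Proof.
elim/apolar_cls_ind=> s; elim/apolar_cls_ind=> t.
by rewrite !apolarME mulrC.
Qed.

Fact apolar1M : left_id apolar1 apolarM.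
Proof. by elim/apolar_cls_ind=> s; rewrite apolarME mul1r. Qed.

HB.instance Definition _ :=
  GRing.isZmodMorphism.Build S (Apolar f) apolar_cls apolar_cls_zmod.

Fact apolarMDl : left_distributive apolarM +%R.
Proof.
elim/apolar_cls_ind=> s; elim/apolar_cls_ind=> t; elim/apolar_cls_ind=> u.
by rewrite -raddfD !apolarME mulrDl raddfD.
Qed.

HB.instance Definition _ := GRing.Zmodule_isComPzRing.Build (Apolar f)
  apolarMA apolarMC apolar1M apolarMDl.

Fact apolar_cls_monoid : monoid_morphism apolar_cls.
Proof. by split=> // s t; rewrite -apolarME. Qed.

HB.instance Definition _ :=
  GRing.isMonoidMorphism.Build S (Apolar f) apolar_cls apolar_cls_monoid.

Definition apolarC (c : k) : Apolar f := apolar_cls (algmap c).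

Fact apolarC_zmod : zmod_morphism apolarC.
Proof. by move=> c d; rewrite /apolarC !rmorphB. Qed.

Fact apolarC_monoid : monoid_morphism apolarC.
Proof. by split=> [|c d]; rewrite /apolarC ?rmorph1 // !rmorphM. Qed.

HB.instance Definition _ :=
  hasAlgebraMap.Build k (Apolar f) apolarC_zmod apolarC_monoid.

End ApolarRing.

End Apolar.

Section IdealPowers.

Variables (A : comPzRingType) (I : A -> Prop).

(* For an ideal I: I^0 = A, and I^(m+1) is the set of finite sums of products
   y z with y in I and z in I^m. *)
Fixpoint ideal_pow (m : nat) : A -> Prop :=
  if m is m'.+1 then
    fun x => exists2 yz : seq (A * A),
      forall p, p \in yz -> I p.1 /\ ideal_pow m' p.2
      & x = \sum_(p <- yz) p.1 * p.2
  else fun=> True.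

Definition ipow m : {pred A} := fun x => `[< ideal_pow m x >].

Lemma ipowP m x : reflect (ideal_pow m x) (x \in ipow m).
Proof. exact: asboolP. Qed.

Lemma ideal_pow_sum m (T : eqType) (r : seq T) (F : T -> A) :
  (forall i, i \in r -> ideal_pow m (F i)) -> ideal_pow m (\sum_(i <- r) F i).
Proof.
case: m => [//|m] rF; elim: r rF => [|i r IHr] rF.
  by exists [::] => //; rewrite !big_nil.
have /IHr[s sI e] : forall j, j \in r -> ideal_pow m.+1 (F j).
  by move=> j jr; apply: rF; rewrite inE jr orbT.
have [s' s'I Fi] := rF i (mem_head _ _).
exists (s' ++ s); last by rewrite big_cons e Fi big_cat.
by move=> p; rewrite mem_cat => /orP[/s'I|/sI].
Qed.

Lemma ideal_pow_mull m a x : ideal_pow m x -> ideal_pow m (a * x).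
Proof.
elim: m x => [//|m IHm] x [s sI ->].
exists [seq (p.1, a * p.2) | p <- s].
  by move=> _ /mapP[p /sI[p1 p2] ->]; split=> //; apply: IHm.
by rewrite big_map mulr_sumr; apply: eq_bigr => p _; rewrite mulrCA.
Qed.

Lemma ideal_powM i j x y :
  ideal_pow i x -> ideal_pow j y -> ideal_pow (i + j) (x * y).
Proof.
elim: i x => [|i IHi] x; first by move=> _; apply: ideal_pow_mull.
case=> s sI -> jy; exists [seq (p.1, p.2 * y) | p <- s].
  by move=> _ /mapP[p /sI[p1 p2] ->]; split=> //; apply: IHi.
by rewrite big_map mulr_suml; apply: eq_bigr => p _; rewrite mulrA.
Qed.

Lemma ideal_powS m x : ideal_pow m.+1 x -> ideal_pow m x.
Proof.
by case=> s sI ->; apply: ideal_pow_sum => p /sI[_]; apply: ideal_pow_mull.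
Qed.

Fact ipow_zmod_closed m : zmod_closed (ipow m).
Proof.
split=> [|x y /ipowP mx /ipowP my]; apply/ipowP.
  by rewrite -(big_nil 0 +%R xpredT (fun i : nat => 0 : A));
    apply: (@ideal_pow_sum m nat [::]).
have -> : x - y = \sum_(i <- [:: true; false]) (if i then x else - y).
  by rewrite !big_cons big_nil addr0.
apply: ideal_pow_sum => -[] _ //; rewrite -mulN1r; exact: ideal_pow_mull.
Qed.

HB.instance Definition _ m :=
  GRing.isZmodClosed.Build A (ipow m) (ipow_zmod_closed m).

Lemma ipowM m i j x y : m = (i + j)%N ->
  x \in ipow i -> y \in ipow j -> x * y \in ipow m.
Proof. by move=> -> /ipowP ix /ipowP jy; apply/ipowP/ideal_powM. Qed.

Lemma ipowS m x : x \in ipow m.+1 -> x \in ipow m.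
Proof. by move=> /ipowP mx; apply/ipowP/ideal_powS. Qed.

Record ipow_type m := Ipow { ipow_val : A; _ : ipow_val \in ipow m }.

HB.instance Definition _ m := [isSub for @ipow_val m].
HB.instance Definition _ m := [Choice of ipow_type m by <:].
HB.instance Definition _ m := [SubChoice_isSubZmodule of ipow_type m by <:].

Definition ipow_next m : {pred ipow_type m} := fun x => val x \in ipow m.+1.

Lemma ipow_nextE m (x : ipow_type m) :
  (x \in @ipow_next m) = (val x \in ipow m.+1).
Proof. by []. Qed.

Fact ipow_next_zmod_closed m : zmod_closed (@ipow_next m).
Proof.
split=> [|x y]; rewrite !ipow_nextE; first by rewrite raddf0 rpred0.
by move=> mx my; rewrite raddfB rpredB.
Qed.

HB.instance Definition _ m := GRing.isZmodClosed.Build (ipow_type m)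
  (@ipow_next m) (@ipow_next_zmod_closed m).

(* I^m / I^(m+1) *)
Definition gr_piece m := Quotient.quot (@ipow_next m).

HB.instance Definition _ m := GRing.Zmodule.on (gr_piece m).
HB.instance Definition _ m := Quotient.on (gr_piece m).

(* The class of x in I^m / I^(m+1); the value for x outside I^m is junk. *)
Definition gr_cls m (x : A) : gr_piece m := \pi_(gr_piece m) (insubd (0 : ipow_type m) x).

Definition gr_lift m (u : gr_piece m) : A := val (repr u).

Lemma gr_lift_in m u : @gr_lift m u \in ipow m.
Proof. exact: valP. Qed.

Lemma gr_liftK m u : gr_cls m (gr_lift u) = u.
Proof. by rewrite /gr_cls /gr_lift valKd reprK. Qed.

Lemma gr_clsP m x y : x \in ipow m -> y \in ipow m ->
  gr_cls m x = gr_cls m y <-> x - y \in ipow m.+1.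
Proof.
move=> mx my; have e : (insubd (0 : ipow_type m) x - insubd 0 y \in @ipow_next m)
    = (x - y \in ipow m.+1) by rewrite ipow_nextE raddfB /= !insubdK.
split=> [/eqP|] xy; first by rewrite -e Quotient.idealrBE.
by apply/eqP; rewrite -Quotient.idealrBE e.
Qed.

Lemma gr_clsB m x y : x \in ipow m -> y \in ipow m ->
  gr_cls m (x - y) = gr_cls m x - gr_cls m y.
Proof.
move=> mx my; rewrite /gr_cls -raddfB; congr (\pi_(gr_piece m) _).
by apply: val_inj; rewrite raddfB /= !insubdK // rpredB.
Qed.

Lemma gr_cls0 m : gr_cls m 0 = 0.
Proof. by rewrite -[X in gr_cls m X](subrr 0) gr_clsB ?rpred0 // subrr. Qed.

Lemma gr_clsD m x y : x \in ipow m -> y \in ipow m ->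
  gr_cls m (x + y) = gr_cls m x + gr_cls m y.
Proof.
move=> mx my; rewrite -[y in LHS]opprK gr_clsB ?rpredN // -[- y]sub0r.
by rewrite gr_clsB ?rpred0 // gr_cls0 sub0r opprK.
Qed.

Lemma gr_cls_sum m (T : Type) (r : seq T) (P : pred T) (F : T -> A) :
    (forall i, P i -> F i \in ipow m) ->
  gr_cls m (\sum_(i <- r | P i) F i) = \sum_(i <- r | P i) gr_cls m (F i).
Proof.
move=> PF; pose Q x u := x \in ipow m /\ gr_cls m x = u.
suff [] : Q (\sum_(i <- r | P i) F i) (\sum_(i <- r | P i) gr_cls m (F i)) by [].
apply: (big_ind2 Q) => [|x u y v [mx <-] [my <-]|i /PF mi]; split=> //.
- exact: rpred0.
- exact: gr_cls0.
- exact: rpredD.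
- exact: gr_clsD.
Qed.

(* The direct sum of the I^m / I^(m+1). *)
Record gr := Gr {
  gr_fun :> forall m, gr_piece m;
  gr_finite : exists N, forall m, (N <= m)%N -> gr_fun m = 0
}.

Lemma grP (g h : gr) : (forall m, g m = h m) -> g = h.
Proof.
case: g h => [g g0] [h h0] /= gh.
have {}gh : g = h by apply: functional_extensionality_dep.
by case: h / gh h0 => h0; congr Gr; apply: Prop_irrelevance.
Qed.

HB.instance Definition _ := gen_eqMixin gr.
HB.instance Definition _ := gen_choiceMixin gr.

Fact gr0_finite : exists N, forall m, (N <= m)%N -> (0 : gr_piece m) = 0.
Proof. by exists 0%N. Qed.
Fact grN_finite (g : gr) : exists N, forall m, (N <= m)%N -> - g m = 0.
Proof. by have [N gN] := gr_finite g; exists N => m /gN->; rewrite oppr0. Qed.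
Fact grD_finite (g h : gr) : exists N, forall m, (N <= m)%N -> g m + h m = 0.
Proof.
have [[N gN] [M hM]] := (gr_finite g, gr_finite h); exists (maxn N M) => m.
by rewrite geq_max => /andP[/gN-> /hM->]; rewrite addr0.
Qed.

Definition gr0 : gr := Gr gr0_finite.
Definition grN g : gr := Gr (grN_finite g).
Definition grD g h : gr := Gr (grD_finite g h).

Fact grDA : associative grD.
Proof. by move=> g h l; apply: grP => m; apply: addrA. Qed.
Fact grDC : commutative grD.
Proof. by move=> g h; apply: grP => m; apply: addrC. Qed.
Fact gr0D : left_id gr0 grD.
Proof. by move=> g; apply: grP => m; apply: add0r. Qed.
Fact grND : left_inverse gr0 grN grD.
Proof. by move=> g; apply: grP => m; apply: addNr. Qed.

HB.instance Definition _ := GRing.isZmodule.Build gr grDA grDC gr0D grND.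

(* The degree m component of a product: (x + I^(i+1)) (y + I^(j+1)) is
   x y + I^(m+1) for i + j = m. *)
Definition gr_mul_fun (g h : forall m, gr_piece m) m : gr_piece m :=
  \sum_(i < m.+1) gr_cls m (gr_lift (g i) * gr_lift (h (m - i)%N)).

Definition gr_conv (F G : nat -> A) m := \sum_(i < m.+1) F i * G (m - i)%N.

Lemma ipow_conv F G : (forall m, F m \in ipow m) -> (forall m, G m \in ipow m) ->
  forall m, gr_conv F G m \in ipow m.
Proof.
move=> FI GI m; apply: rpred_sum => i _.
by apply: ipowM (FI i) (GI _); rewrite subnKC // -ltnS.
Qed.

Lemma gr_cls_liftM m i j x y : m = (i + j)%N -> x \in ipow i -> y \in ipow j ->
  gr_cls m (gr_lift (gr_cls i x) * gr_lift (gr_cls j y)) = gr_cls m (x * y).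
Proof.
move=> def_m ix jy; set x' := gr_lift _; set y' := gr_lift _.
have [ix' jy'] : x' \in ipow i /\ y' \in ipow j by split; apply: gr_lift_in.
have xx' : x' - x \in ipow i.+1 by apply/gr_clsP => //; apply: gr_liftK.
have yy' : y' - y \in ipow j.+1 by apply/gr_clsP => //; apply: gr_liftK.
apply/gr_clsP; [exact: ipowM def_m _ _ | exact: ipowM def_m _ _ |].
have -> : x' * y' - x * y = x' * (y' - y) + (x' - x) * y.
  by rewrite mulrBr mulrBl addrA subrK.
apply: rpredD; first by apply: ipowM ix' yy'; rewrite def_m addnS.
by apply: ipowM xx' jy; rewrite def_m.
Qed.

Lemma gr_mul_cls (F G : nat -> A) :
    (forall m, F m \in ipow m) -> (forall m, G m \in ipow m) ->
  forall m, gr_mul_fun (fun m => gr_cls m (F m)) (fun m => gr_cls m (G m)) m =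
            gr_cls m (gr_conv F G m).
Proof.
move=> FI GI m; rewrite /gr_mul_fun /gr_conv gr_cls_sum => [|i _].
  by apply: eq_bigr => i _; apply: gr_cls_liftM => //; rewrite subnKC // -ltnS.
by apply: ipowM (FI i) (GI _); rewrite subnKC // -ltnS.
Qed.

Fact gr_mul_finite (g h : gr) :
  exists N, forall m, (N <= m)%N -> gr_mul_fun g h m = 0.
Proof.
have [[N gN] [M hM]] := (gr_finite g, gr_finite h); exists (N + M)%N => m NMm.
rewrite /gr_mul_fun big1 // => i _; have im : (i <= m)%N by rewrite -ltnS.
have [gi hi] := (gr_liftK (g i), gr_liftK (h (m - i)%N)).
have idm : m = (i + (m - i))%N by rewrite subnKC.
have [Ni|iN] := leqP N i.
  rewrite gN // -(gr_cls0 i) -[h _]gr_liftK gr_cls_liftM ?rpred0 ?gr_lift_in //.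
  by rewrite mul0r gr_cls0.
rewrite [h _]hM; last by rewrite leq_subRL // (leq_trans _ NMm) // leq_add2r ltnW.
rewrite -(gr_cls0 (m - i)) -[g i]gr_liftK gr_cls_liftM ?rpred0 ?gr_lift_in //.
by rewrite mulr0 gr_cls0.
Qed.

Definition grM g h : gr := Gr (gr_mul_finite g h).

Definition grC_fun (a : A) m : gr_piece m := gr_cls m (if m == 0%N then a else 0).

Fact grC_finite a : exists N, forall m, (N <= m)%N -> grC_fun a m = 0.
Proof. by exists 1%N => -[//|m] _; apply: gr_cls0. Qed.

(* The class of a in A / I, placed in degree 0. *)
Definition grC a : gr := Gr (grC_finite a).

Lemma ipow_const a m : (if m == 0%N then a else 0) \in ipow m.
Proof. by case: m => [|m]; [apply/ipowP | apply: rpred0]. Qed.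

Lemma gr_mulE (g h : gr) (F G : nat -> A) :
    (forall m, F m \in ipow m) -> (forall m, g m = gr_cls m (F m)) ->
    (forall m, G m \in ipow m) -> (forall m, h m = gr_cls m (G m)) ->
  forall m, grM g h m = gr_cls m (gr_conv F G m).
Proof.
move=> FI gF GI hG m; rewrite -gr_mul_cls //=.
by apply: eq_bigr => i _; rewrite gF hG.
Qed.

Let lift_fun (g : gr) m := gr_lift (g m).
Let lift_fun_in g m : lift_fun g m \in ipow m. Proof. exact: gr_lift_in. Qed.
Let lift_funK (g : gr) m : g m = gr_cls m (lift_fun g m). Proof. by rewrite gr_liftK. Qed.

Lemma gr_convA F G H m : gr_conv F (gr_conv G H) m = gr_conv (gr_conv F G) H m.
Proof.
pose T i j := F i * (G j * H (m - i - j)%N).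
transitivity (\sum_(i < m.+1) \sum_(j < m.+1 | (j <= m - i)%N) T i j).
  apply: eq_bigr => i _; rewrite /gr_conv mulr_sumr.
  by rewrite (big_ord_narrow_leq (leq_subr _ _)).
rewrite /gr_conv; under [RHS]eq_bigr => l _ do rewrite mulr_suml.
transitivity (\sum_(l < m.+1) \sum_(i < m.+1 | (i <= l)%N) T i (l - i)%N);
  last first.
  apply: eq_bigr => l _.
  have lm : (l <= m)%N by rewrite -ltnS.
  rewrite (big_ord_narrow_leq lm) /=; apply: eq_bigr => i _.
  by rewrite /T mulrA -subnDA subnKC // -ltnS.
rewrite [RHS](exchange_big_dep predT) //=; apply: eq_bigr => i _.
have im : (i <= m)%N by rewrite -ltnS.
rewrite -(big_mkord (fun j => j <= m - i)%N (fun j => T i j)).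
rewrite -(big_mkord (fun l => i <= l)%N (fun l => T i (l - i)%N)).
rewrite (big_cat_nat (n := (m - i).+1)) //=; last by rewrite ltnS leq_subr.
rewrite [X in _ + X]big_nat_cond [X in _ + X]big1 ?addr0; last first.
  by move=> j /andP[/andP[lt _] le]; rewrite ltnNge le in lt.
rewrite [RHS](big_cat_nat (n := i)) //=; last exact: leqW.
rewrite [X in _ = X + _]big_nat_cond [X in _ = X + _]big1 ?add0r; last first.
  by move=> j /andP[/andP[_ lt] le]; rewrite ltnNge le in lt.
rewrite -[X in _ = \big[_/_]_(X <= _ < _ | _) _]add0n [RHS]big_addn subSn //.
rewrite big_nat_cond [RHS]big_nat_cond.
apply: eq_big => [j|j _]; last by rewrite addnK.
by rewrite leq_addl andbT /= ltnS andbb.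
Qed.

Fact grMA : associative grM.
Proof.
move=> g h l; apply: grP => m.
have [[Fg Fh] Fl] := (lift_fun_in g, lift_fun_in h, lift_fun_in l).
have [[Kg Kh] Kl] := (lift_funK g, lift_funK h, lift_funK l).
rewrite (gr_mulE Fg Kg (ipow_conv Fh Fl) (gr_mulE Fh Kh Fl Kl)).
by rewrite (gr_mulE (ipow_conv Fg Fh) (gr_mulE Fg Kg Fh Kh) Fl Kl) gr_convA.
Qed.

Fact grMC : commutative grM.
Proof.
move=> g h; apply: grP => m; rewrite /= /gr_mul_fun [LHS](reindex_inj rev_ord_inj).
apply: eq_bigr => i _; rewrite [in LHS]mulrC /=.
have im : (i <= m)%N by rewrite -ltnS.
by rewrite -[gr_lift (h (m - _)%N)]/(lift_fun h (m - (m.+1 - i.+1))%N) subSS subKn //.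
Qed.

Fact gr1M : left_id (grC 1) grM.
Proof.
move=> g; apply: grP => m.
have K1 i : grC 1 i = gr_cls i (if i == 0%N then 1 else 0) by [].
rewrite (gr_mulE (ipow_const 1) K1 (lift_fun_in g) (lift_funK g)).
rewrite [RHS]lift_funK /gr_conv big_ord_recl /= mul1r subn0 big1 ?addr0 //.
by move=> i _; rewrite mul0r.
Qed.

Fact grMDl : left_distributive grM +%R.
Proof.
move=> g h l; apply: grP => m; rewrite -[RHS]/(grM g l m + grM h l m).
have [[Fg Fh] Fl] := (lift_fun_in g, lift_fun_in h, lift_fun_in l).
have [[Kg Kh] Kl] := (lift_funK g, lift_funK h, lift_funK l).
have Fgh i : lift_fun g i + lift_fun h i \in ipow i by apply: rpredD.
have Kgh i : (g + h) i = gr_cls i (lift_fun g i + lift_fun h i).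
  by rewrite gr_clsD // -Kg -Kh.
rewrite (gr_mulE Fgh Kgh Fl Kl) (gr_mulE Fg Kg Fl Kl) (gr_mulE Fh Kh Fl Kl).
rewrite -gr_clsD; try exact: ipow_conv.
by congr gr_cls; rewrite /gr_conv -big_split; apply: eq_bigr => i _; rewrite mulrDl.
Qed.

HB.instance Definition _ := GRing.Zmodule_isComPzRing.Build gr grMA grMC gr1M grMDl.

Fact grC_zmod : zmod_morphism grC.
Proof.
move=> a b; apply: grP => m; rewrite -[RHS]/(grC_fun a m - grC_fun b m) /= /grC_fun.
by rewrite -gr_clsB ?ipow_const //; case: eqP => _; rewrite ?subr0.
Qed.

Fact grC_monoid : monoid_morphism grC.
Proof.
split=> // a b; apply: grP => m; rewrite -[RHS]/(grM (grC a) (grC b) m).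
have K c i : grC c i = gr_cls i (if i == 0%N then c else 0) by [].
rewrite (gr_mulE (ipow_const a) (K a) (ipow_const b) (K b)) K.
rewrite /gr_conv big_ord_recl /= subn0 big1 ?addr0 => [|i _].
  by case: eqP => _; rewrite ?mulr0.
by rewrite mul0r.
Qed.

HB.instance Definition _ := GRing.isZmodMorphism.Build A gr grC grC_zmod.
HB.instance Definition _ := GRing.isMonoidMorphism.Build A gr grC grC_monoid.

End IdealPowers.

Section GradedAlgebra.

Variables (k : comNzRingType) (A : pzComAlgType k) (I : A -> Prop).

Definition gr_algmap (c : k) : gr I := grC I (algmap c).

Fact gr_algmap_zmod : zmod_morphism gr_algmap.
Proof. by move=> c d; rewrite /gr_algmap !rmorphB. Qed.

Fact gr_algmap_monoid : monoid_morphism gr_algmap.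
Proof. by split=> [|c d]; rewrite /gr_algmap ?rmorph1 // !rmorphM. Qed.

HB.instance Definition _ :=
  hasAlgebraMap.Build k (gr I) gr_algmap_zmod gr_algmap_monoid.

End GradedAlgebra.

(* For a local ring A, the set of non-units is its maximal ideal m_A. *)
Definition max_ideal (A : comPzRingType) (x : A) : Prop := ~ exists y, y * x = 1.

Section PolynomialSpace.

Variables (n : nat) (k : fieldType).

Implicit Types (s t : mseries n k) (f : dpoly n k).

(* P_{<= d} *)
Definition dpoly_le d f : Prop := forall a, coeff a f != 0 -> (mdeg a <= d)%N.

Definition dpoly_degree d f : Prop :=
  dpoly_le d f /\ exists a, mdeg a = d /\ coeff a f != 0.

(* Coordinates on the affine space P_{<= d}, indexed by its monomial basis. *)
Definition dpoly_coords d f : 'I_#|{: 'X_{1..n < d.+1}}| -> k :=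
  fun i => coeff (enum_val i : 'X_{1..n}) f.

Arguments dpoly_coords d f i : clear implicits.

(* U is the complement in P_{<= d} of the common zero locus of a set E of
   polynomial functions. *)
Definition zariski_open d (U : dpoly n k -> Prop) : Prop :=
  (forall f, U f -> dpoly_le d f) /\
  exists E : {mpoly k[#|{: 'X_{1..n < d.+1}}|]} -> Prop,
    forall f, dpoly_le d f -> (U f <-> exists2 p, E p & p.@[dpoly_coords d f] != 0).

Lemma dpoly_le_ex f : exists d, dpoly_le d f.
Proof.
exists (\max_(a <- dom f) mdeg a)%N => a; rewrite -mem_dom => af.
exact: leq_bigmax_seq.
Qed.

Lemma contract_eq0 d s f : dpoly_le d f ->
  (forall a, (mdeg a <= d)%N -> s a = 0) -> contract s f = 0.
Proof.
move=> fd sd; apply: dpolyP => c; rewrite coeff_contract coeff0 big1_seq //.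
move=> b /andP[_]; rewrite mem_dom => /fd bd.
by rewrite sd ?mulr0 // (leq_trans (mdegB _ _)).
Qed.

Lemma mseriesM0 s t : (s * t) 0%MM = s 0%MM * t 0%MM.
Proof.
rewrite (@mseriesM_lin _ _ _ _ _ 1%N) ?mdeg0 // (big_pred1 bm0) /= ?subm0 //.
move=> a; have a0 : a = bm0.
  by apply: val_inj; apply/eqP; rewrite -mdeg_eq0 -leqn0 -ltnS bmdeg.
by rewrite a0 /= eqxx lepm_refl.
Qed.

Lemma mseriesX_eq0 s N a : s 0%MM = 0 -> (mdeg a < N)%N -> (s ^+ N) a = 0.
Proof.
move=> s0; elim: N a => [//|N IHN] a aN; rewrite exprS.
rewrite (@mseriesM_lin _ _ _ _ _ N.+1) // big1 // => b ba.
have [->|b0] := eqVneq (b : 'X_{1..n}) 0%MM; first by rewrite s0 mul0r.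
rewrite IHN ?mulr0 // -ltnS (leq_trans _ aN) // ltnS.
have /(congr1 mdeg) := submK ba; rewrite mdegD => <-.
by rewrite -addn1 leq_add2l lt0n mdeg_eq0.
Qed.

Lemma max_ideal_apolar f s : f != 0 ->
  max_ideal (apolar_cls f s) <-> s 0%MM = 0.
Proof.
move=> f0; have [d fd] := dpoly_le_ex f.
have nil t : t 0%MM = 0 -> contract (t ^+ d.+1) f = 0.
  by move=> t0; apply: contract_eq0 fd _ => a ad; apply: mseriesX_eq0.
split=> [ms|s0 [y]]; last first.
  elim/apolar_cls_ind: y => t; rewrite -rmorphM -(rmorph1 (apolar_cls f)).
  move=> /apolar_clsP; rewrite unfold_in contractBl subr_eq0 => /eqP ts.
  have /nil : (t * s) 0%MM = 0 by rewrite mseriesM0 s0 mulr0.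
  have -> N : contract ((t * s) ^+ N) f = contract 1 f.
    by elim: N => // N IHN; rewrite exprSr contractM ts -contractM mulr1.
  by rewrite contract1 => /eqP; rewrite (negbTE f0).
have [//|s0] := eqVneq (s 0%MM) 0; case: ms.
pose c : mseries n k := algmap (s 0%MM)^-1; pose t := 1 - c * s.
have t0 : t 0%MM = 0.
  rewrite -[LHS]/(@mseriesC n k 1 0%MM - (c * s) 0%MM) mseriesM0.
  by rewrite -[c _]/(@mseriesC n k _ 0%MM) /mseriesC eqxx mulVf ?subrr.
exists (apolar_cls f ((\sum_(i < d.+1) t ^+ i) * c)).
rewrite -rmorphM -(rmorph1 (apolar_cls f)); apply/apolar_clsP.
have -> : (\sum_(i < d.+1) t ^+ i) * c * s = 1 - t ^+ d.+1.
  by rewrite -mulrA -[c * s](subKr 1) -/t mulrC -opprB mulNr -subrX1 opprB.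
by rewrite addrAC subrr add0r unfold_in -sub0r contractBl nil // contract0l subr0.
Qed.

(* [Apolar f] is local for f <> 0. *)
Lemma apolar_local f : f != 0 ->
  [/\ ~ max_ideal (1 : Apolar f),
      forall x y : Apolar f, max_ideal x -> max_ideal y -> max_ideal (x + y)
    & forall x y : Apolar f, max_ideal y -> max_ideal (x * y)].
Proof.
move=> f0; split.
- by case; exists 1; rewrite mulr1.
- elim/apolar_cls_ind=> s; elim/apolar_cls_ind=> t.
  rewrite -rmorphD !max_ideal_apolar // => s0 t0.
  by rewrite -[LHS]/(s 0%MM + t 0%MM) s0 t0 addr0.
- elim/apolar_cls_ind=> s; elim/apolar_cls_ind=> t.
  by rewrite -rmorphM !max_ideal_apolar // mseriesM0 => ->; rewrite mulr0.
Qed.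

End PolynomialSpace.

Arguments dpoly_coords {n k} d f i.

Definition canonically_graded (n : nat) (k : fieldType) (f : dpoly n k) : Prop :=
  alg_isomorphic (Apolar f) (gr (@max_ideal (Apolar f))).

(* Main.v *)
(** The apolar algebra of f is determined by the functional
    s |-> (constant coefficient of s acting on f).  If a unit u of S and a system
    of coordinates h of S make s |-> form (u * s(h)) homogeneous, then Apolar f is
    presented in the coordinates h by a homogeneous ideal, hence is isomorphic to
    its associated graded algebra.  For a quintic f the failure of homogeneity in
    degrees d = 4, 3, 2, 1, 0 is removed successively, by adding to u a form of
    degree 5 - d and to h_1 a form of degree 6 - d: to first order this only
    involves the leading form of f, and the corrections solve a square linear
    system whose determinant is a polynomial in the coefficients of that form.
    The open set is the locus where none of the five determinants vanishes. *)

Require Import Defs.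
From HB Require Import structures.
From mathcomp Require Import all_boot all_algebra.
From mathcomp Require Import boolp.
From mathcomp Require Import freeg mpoly ring zify.

Set Implicit Arguments.
Unset Strict Implicit.
Unset Printing Implicit Defensive.

Import GRing.Theory.

(** * Homogeneous parts and orders of polynomials *)

Section HomogeneousParts.

Local Open Scope ring_scope.

Variables (n : nat) (k : comNzRingType).

Implicit Types (p q : {mpoly k[n]}) (a b : 'X_{1..n}).

Local Notation hpart := (pihomog mdeg).

Lemma mcoeff_pihomog d p a :
  (hpart d p)@_a = if mdeg a == d then p@_a else 0.
Proof.
elim/mpolyind: p => [|c m p _ _ IHp]; first by rewrite raddf0 !mcoeff0 if_same.
rewrite raddfD /= linearZ /= pihomogX !mcoeffD !mcoeffZ IHp (fun_if (mcoeff a)).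
rewrite mcoeffX mcoeff0; have [->|ma] := eqVneq m a; first by case: eqP; rewrite ?mulr0 ?addr0.
by rewrite if_same mulr0 !add0r.
Qed.

Definition mord_ge d p : Prop := forall a, (mdeg a < d)%N -> p@_a = 0.

Lemma mord_geP d p : mord_ge d p <-> forall a, p@_a != 0 -> (d <= mdeg a)%N.
Proof.
split=> dp a => [|ad]; first by rewrite leqNgt; apply: contraNN => /dp ->.
by apply: contraTeq ad => /dp; rewrite leqNgt.
Qed.

Lemma mord_geD d p q : mord_ge d p -> mord_ge d q -> mord_ge d (p + q).
Proof. by move=> dp dq a ad; rewrite mcoeffD dp ?dq ?addr0. Qed.

Lemma mord_geM c d p q : mord_ge c p -> mord_ge d q -> mord_ge (c + d) (p * q).
Proof.
move=> cp dq a ad; rewrite mcoeffM big1 // => -[[i ci] [j cj]] /= /eqP aij.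
have [ic|ci'] := ltnP (mdeg i) c; first by rewrite cp ?mul0r.
rewrite [q@_j]dq ?mulr0 // -(ltn_add2l c) (leq_ltn_trans _ ad) //.
by rewrite aij mdegD leq_add2r.
Qed.

Lemma mord_ge_pihomog d p : mord_ge d (hpart d p).
Proof. by move=> a ad; rewrite mcoeff_pihomog ltn_eqF. Qed.

Lemma mord_ge_sub_pihomog d p :
  mord_ge d p -> mord_ge d.+1 (p - hpart d p).
Proof.
move=> dp a ad; rewrite mcoeffB mcoeff_pihomog; case: eqP => [_|ne].
  by rewrite subrr.
by rewrite subr0 dp // ltn_neqAle -ltnS ad andbT; apply/eqP.
Qed.

Lemma pihomog_large p d : (msize p <= d)%N -> hpart d p = 0.
Proof.
move=> pd; apply/mpolyP => a; rewrite mcoeff_pihomog mcoeff0; case: eqP => // ad.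
by apply/memN_msupp_eq0/msize_mdeg_ge; rewrite ad.
Qed.

(** Both factors are expanded into homogeneous parts below a common bound [K]; the product of parts
    of degrees i and j is homogeneous of degree i + j, so only i + j = m survives. *)
Lemma pihomogM m p q : hpart m (p * q) = \sum_(i < m.+1) hpart i p * hpart (m - i) q.
Proof.
pose E (r : {mpoly k[n]}) := forall K, (msize r <= K)%N -> r = \sum_(d < K) hpart d r.
have homE r : E r by move=> K rK; apply: pihomog_partitionE.
pose K := maxn m.+1 (maxn (msize p) (msize q)).
have mK : (m < K)%N by rewrite leq_max leqnn.
rewrite {1}(homE p K) ?leq_max ?leqnn ?orbT // {1}(homE q K) ?leq_max ?leqnn ?orbT //.
rewrite mulr_suml raddf_sum /=.
have key i j : hpart m (hpart i p * hpart j q) =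
    if (i + j == m)%N then hpart i p * hpart j q else 0.
  have H := dhomogM (pihomogP mdeg i p) (pihomogP mdeg j q).
  by case: eqP => [e|/eqP ne]; [rewrite -e pihomog_dE | rewrite (pihomog_ne0 ne)].
rewrite (eq_bigr (fun i : 'I_K =>
  if (i <= m)%N then hpart i p * hpart (m - i) q else 0)) => [|i _].
  by rewrite -big_mkcond (big_ord_narrow mK).
rewrite mulr_sumr raddf_sum /=.
under eq_bigr => j _ do rewrite key.
case: leqP => im.
  have miK : (m - i < K)%N by rewrite (leq_ltn_trans (leq_subr _ _)).
  rewrite (bigD1 (Ordinal miK)) //= subnKC // eqxx big1 ?addr0 // => j.
  by rewrite -val_eqE /=; case: (i + j =P m)%N => // <-; rewrite addKn eqxx.
by rewrite big1 // => j _; case: eqP => // e; rewrite -e ltnNge leq_addr in im.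
Qed.

End HomogeneousParts.

(** * Algebras presented by a homogeneous ideal are isomorphic to their associated graded algebra *)

Section GradedPresentation.

Local Open Scope ring_scope.

Variables (n : nat) (k : comNzRingType) (A : pzComAlgType k) (I : A -> Prop).
Implicit Types p q : {mpoly k[n]}.
Variable psi : {rmorphism {mpoly k[n]} -> A}.
Local Notation hpart := (pihomog mdeg).

Hypothesis psiC : forall c : k, psi c%:MP = algmap c.
Hypothesis psi_surj : forall a, exists p, psi p = a.
Hypothesis psi_I : forall p, I (psi p) <-> p@_0 = 0.
Hypothesis ker_homog :
  forall p d, psi p = 0 -> psi (hpart d p) = 0.

(** By induction on d, one variable is split off each monomial; its image lies in I because it has
    no constant term. *)
Lemma psi_ipow d p : mord_ge d p -> psi p \in ipow I d.
Proof.
move=> /mord_geP dp; rewrite [p]mpolyE rmorph_sum rpred_sum // => i _.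
rewrite -mul_mpolyC rmorphM.
have [ci0|ci0] := eqVneq p@_i 0; first by rewrite ci0 mpolyC0 rmorph0 mul0r rpred0.
apply/ipowP/ideal_pow_mull; move: (dp i ci0) => {ci0 dp}; elim: d i => // d IHd i di.
have i0 : i != 0%MM by rewrite -mdeg_eq0 -lt0n (leq_trans _ di).
have [j ij] : exists j, (0 < i j)%N.
  apply/existsP; move: i0; apply: contra_neqT; rewrite negb_exists => /forallP i0.
  by apply/mnmP => j; rewrite mnm0E; apply/eqP; rewrite -leqn0 leqNgt i0.
have Uji : (U_(j) <= i)%MM by rewrite lep1mP -lt0n.
have e : mdeg i = (mdeg (i - U_(j))).+1 by rewrite -[in LHS](submK Uji) mdegD mdeg1 addn1.
exists [:: (psi 'X_j, psi 'X_[i - U_(j)])].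
  move=> q; rewrite inE => /eqP -> /=; split; last by apply: IHd; rewrite -ltnS -e.
  by apply/psi_I; rewrite mcoeffX -mdeg_eq0 mdeg1.
by rewrite big_seq1 /= -rmorphM -mpolyXD addmC submK.
Qed.

(** In each product y z with y in I and z in the previous power, y lifts to a polynomial without
    constant term and z, inductively, to one of the previous order. *)
Lemma ipow_psi d a : a \in ipow I d -> exists2 p, mord_ge d p & psi p = a.
Proof.
move=> /ipowP; elim: d a => [|d IHd] a; first by have [p <-] := psi_surj a; exists p.
case=> s; elim: s a => [|[y z] s IHs] a sI ->.
  by exists 0 => [b _|]; rewrite ?mcoeff0 // rmorph0 big_nil.
have [||p dp ps] := IHs (\sum_(p <- s) p.1 * p.2) => //.
  by move=> q qs; apply: sI; rewrite inE qs orbT.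
have [yI zI] := sI _ (mem_head _ _).
have [q qy] := psi_surj y; have [r dr rz] := IHd _ zI.
exists (q * r + p); last by rewrite big_cons rmorphD rmorphM ps qy rz.
apply: mord_geD dp; rewrite -add1n; apply: mord_geM dr => b.
rewrite ltnS leqn0 mdeg_eq0 => /eqP ->; by apply/psi_I; rewrite qy.
Qed.

Lemma psi_homog_ipow d p : psi (hpart d p) \in ipow I d.
Proof. exact/psi_ipow/mord_ge_pihomog. Qed.

(* The kernel being homogeneous, the leading part of a relation is a relation. *)
Lemma psi_homog_eq0 d p : psi (hpart d p) \in ipow I d.+1 -> psi (hpart d p) = 0.
Proof.
case/ipow_psi=> q dq qp; have : psi (hpart d p - q) = 0 by rewrite raddfB /= qp subrr.
move=> /(ker_homog d); rewrite raddfB /= pihomog_id.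
suff -> : hpart d q = 0 by rewrite subr0.
apply/mpolyP => a; rewrite mcoeff_pihomog mcoeff0; case: eqP => // ad.
by apply: dq; rewrite ad.
Qed.

Fact theta_finite p :
  exists N, forall m, (N <= m)%N -> gr_cls I m (psi (hpart m p)) = 0.
Proof. by exists (msize p) => m /pihomog_large ->; rewrite raddf0 gr_cls0. Qed.

(** The graded counterpart of [psi]. It will be shown to be a surjective homomorphism with the same
    kernel as [psi]. *)
Definition theta p : gr I := Gr (theta_finite p).

Lemma thetaB p q : theta (p - q) = theta p - theta q.
Proof.
apply: grP => m; rewrite -[RHS]/(theta p m - theta q m) /= !raddfB /=.
by rewrite gr_clsB ?psi_homog_ipow.
Qed.

Lemma thetaM p q : theta (p * q) = theta p * theta q.
Proof.
apply: grP => m; rewrite -[RHS]/(grM (theta p) (theta q) m).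
rewrite (@gr_mulE _ _ (theta p) (theta q) (fun m => psi (hpart m p))
  (fun m => psi (hpart m q))) //; try by move=> i; apply: psi_homog_ipow.
rewrite /= pihomogM rmorph_sum; congr gr_cls; apply: eq_bigr => i _.
by rewrite rmorphM.
Qed.

Lemma thetaC c : theta c%:MP = algmap c.
Proof.
apply: grP => m; rewrite -[RHS]/(grC_fun I (algmap c) m) /grC_fun /=; congr gr_cls.
rewrite -psiC; have -> : hpart m c%:MP = if m == 0%N then c%:MP else 0 :> {mpoly k[n]}.
  apply/mpolyP => a; rewrite mcoeff_pihomog (fun_if (mcoeff a)) mcoeffC mcoeff0.
  rewrite -mdeg_eq0; case: (m =P 0%N) => [->|m0].
    by case: eqP => // _; rewrite mulr0.
  by case: eqP => // ->; case: eqP => // _; rewrite mulr0.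
by case: eqP => // _; rewrite raddf0.
Qed.

Lemma theta_eq0 p : theta p = 0 <-> psi p = 0.
Proof.
split=> [tp|pp]; last first.
  by apply: grP => m; rewrite /= ker_homog // gr_cls0.
have -> : p = \sum_(d < msize p) hpart d p by exact: pihomog_partitionE.
rewrite raddf_sum big1 // => d _; apply: psi_homog_eq0.
rewrite -[X in X \in _]subr0; apply/gr_clsP; rewrite ?rpred0 ?psi_homog_ipow //.
by rewrite -[LHS]/(theta p d) tp gr_cls0.
Qed.

Lemma theta_surj (g : gr I) : exists p, theta p = g.
Proof.
have [N gN] := gr_finite g.
have /choice[P PP] : forall m, exists p, mord_ge m p /\ psi p = gr_lift (g m).
  by move=> m; have [p mp pg] := ipow_psi (gr_lift_in (g m)); exists p.
exists (\sum_(m < N) hpart m (P m)); apply: grP => m.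
rewrite /= -[RHS]gr_liftK; have [mP <-] := PP m.
have -> : hpart m (\sum_(m0 < N) hpart m0 (P m0)) = if (m < N)%N then hpart m (P m) else 0.
  rewrite raddf_sum /=; case: ltnP => mN.
    rewrite (bigD1 (Ordinal mN)) //= pihomog_id big1 ?addr0 // => i.
    by rewrite -val_eqE /= => im; rewrite (pihomog_ne0 im) // pihomogP.
  rewrite big1 // => i _; rewrite (@pihomog_ne0 _ _ _ i) ?pihomogP //.
  by rewrite neq_ltn (leq_trans (ltn_ord i) mN).
(* [P m] has order at least m, so it differs from its part of degree m by terms of order m + 1,
   which vanish in the m-th graded piece. *)
case: ltnP => mN.
  apply/gr_clsP; rewrite ?psi_homog_ipow ?psi_ipow //.
  by rewrite -opprB -raddfB rpredN; apply/psi_ipow/mord_ge_sub_pihomog.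
by rewrite raddf0 gr_cls0; have [_ ->] := PP m; rewrite gr_liftK gN.
Qed.

(* A and gr A have the same presentation as quotients of the polynomial ring. *)
Lemma alg_isomorphic_gr : alg_isomorphic A (gr I).
Proof.
have /choice[rep repK] := psi_surj.
pose phi a := theta (rep a).
have phi_psi p : phi (psi p) = theta p.
  apply/eqP; rewrite -subr_eq0 -thetaB; apply/eqP/theta_eq0.
  by rewrite raddfB /= repK subrr.
have phi_zmod : zmod_morphism phi.
  by move=> a b; rewrite -{1}[a]repK -{1}[b]repK -raddfB phi_psi thetaB.
have phi_monoid : monoid_morphism phi.
  split=> [|a b]; last by rewrite -{1}[a]repK -{1}[b]repK -rmorphM phi_psi thetaM.
  by rewrite -(rmorph1 psi) phi_psi -mpolyC1 thetaC rmorph1.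
pose phiZ := GRing.isZmodMorphism.Build _ _ phi phi_zmod.
pose phiM := GRing.isMonoidMorphism.Build _ _ phi phi_monoid.
pose Phi : {rmorphism A -> gr I} := HB.pack phi phiZ phiM.
exists Phi => [|c]; last by rewrite -psiC [LHS]phi_psi thetaC.
have /choice[inv invK] : forall g, exists a, phi a = g.
  by move=> g; have [p <-] := theta_surj g; exists (psi p).
exists inv => [a|g]; last exact: invK.
have phi_inj : injective phi.
  move=> b c bc; apply/eqP; rewrite -subr_eq0 -(repK (b - c)); apply/eqP/theta_eq0.
  by rewrite -[LHS]/(phi (b - c)) phi_zmod bc subrr.
exact/phi_inj/invK.
Qed.

End GradedPresentation.

(** * Orders of power series and first-order Taylor estimates *)

Lemma subr_exprS (R : comNzRingType) (x y : R) i :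
  (x ^+ i.+1 - y ^+ i.+1 = x * (x ^+ i - y ^+ i) + (x - y) * y ^+ i)%R.
Proof. by rewrite !exprS; ring. Qed.

(** Recursion in i for the error of the linear expansion of [(x + a) ^+ i] around x, with the
    derivative evaluated at an approximation y of x. For i = 0 the truncated exponent [i.-1] is
    harmless, since the term has multiplicity 0. *)
Lemma taylor_step (R : comNzRingType) (x y a : R) i :
  ((x + a) ^+ i.+1 - x ^+ i.+1 - y ^+ i * a *+ i.+1 =
    (x + a) * ((x + a) ^+ i - x ^+ i - y ^+ i.-1 * a *+ i) + a * (x ^+ i - y ^+ i)
    + (x - y + a) * (y ^+ i.-1 * a *+ i))%R.
Proof.
case: i => [|i]; first by rewrite /= !expr0 mulr0n mulr1n; ring.
rewrite mulrSr -(mulr_natr (y ^+ i.+1 * a)) -(mulr_natr (y ^+ i * a)).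
rewrite (exprS _ i.+1) (exprS x i.+1) (exprS y i).
ring.
Qed.

Section SeriesOrder.

Local Open Scope ring_scope.

Variables (n : nat) (k : comNzRingType).

Implicit Types (s t : mseries n k) (p q : {mpoly k[n]}).

(** This is membership in the d-th power of the ideal of series without constant term. *)
Record sord_ge d s : Prop := SordGe { sord_geE : forall a, (mdeg a < d)%N -> s a = 0 }.

Lemma sord_ge0 s : sord_ge 0 s.
Proof. by []. Qed.

Lemma sord_ge_zero d : sord_ge d 0.
Proof. by []. Qed.

Lemma sord_ge_le c d s : (d <= c)%N -> sord_ge c s -> sord_ge d s.
Proof. by move=> dc [cs]; split=> a /leq_trans/(_ dc)/cs. Qed.

Lemma sord_geD d s t : sord_ge d s -> sord_ge d t -> sord_ge d (s + t).
Proof.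
by move=> [ds] [dt]; split=> a ad; rewrite -[LHS]/(s a + t a) ds // dt // addr0.
Qed.

Lemma sord_geN d s : sord_ge d s -> sord_ge d (- s).
Proof. by move=> [ds]; split=> a ad; rewrite -[LHS]/(- s a) ds // oppr0. Qed.

Lemma sord_geB d s t : sord_ge d s -> sord_ge d t -> sord_ge d (s - t).
Proof. by move=> ds dt; apply/sord_geD/sord_geN. Qed.

Lemma sord_geMn d s m : sord_ge d s -> sord_ge d (s *+ m).
Proof.
move=> ds; elim: m => [|m IHm]; first exact: sord_ge_zero.
by rewrite mulrS; apply: sord_geD.
Qed.

Lemma sord_ge_sum d (T : Type) (r : seq T) (P : pred T) (F : T -> mseries n k) :
  (forall i, P i -> sord_ge d (F i)) -> sord_ge d (\sum_(i <- r | P i) F i).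
Proof. by move=> dF; apply: big_ind => //; exact: sord_geD. Qed.

Lemma sord_geM c d e s t : (e <= c + d)%N ->
  sord_ge c s -> sord_ge d t -> sord_ge e (s * t).
Proof.
move=> ecd [cs] [dt]; split=> a ae; rewrite -[LHS]/(mseriesM s t a) /mseriesM big1 //.
move=> -[[i ci] [j cj]] /= /eqP aij.
have [ic|ci'] := ltnP (mdeg i) c; first by rewrite cs ?mul0r.
rewrite [t j]dt ?mulr0 // -(ltn_add2l c) (leq_trans _ ecd) //.
by rewrite (leq_ltn_trans _ ae) // aij mdegD leq_add2r.
Qed.

Lemma sord_geMl d s t : sord_ge d t -> sord_ge d (s * t).
Proof. by apply: sord_geM (sord_ge0 s). Qed.

Lemma sord_geX m d s : sord_ge d s -> sord_ge (m * d) (s ^+ m).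
Proof.
move=> ds; elim: m => [|m IHm]; first exact: sord_ge0.
rewrite exprS.
by apply: (sord_geM _ ds IHm); rewrite mulSn.
Qed.

Definition mseries_of p : mseries n k := fun a => p@_a.

Fact mseries_of_zmod : zmod_morphism mseries_of.
Proof. by move=> p q; apply: funext => a; apply: mcoeffB. Qed.

Fact mseries_of_monoid : monoid_morphism mseries_of.
Proof.
split=> [|p q]; apply: funext => a.
  by rewrite /mseries_of mcoeff1 -[RHS]/(@mseriesC n k 1 a) /mseriesC; case: eqP.
by rewrite -[RHS]/(mseriesM _ _ a) (@mseriesM_mcoeff _ _ _ _ p q).
Qed.

HB.instance Definition _ :=
  GRing.isZmodMorphism.Build {mpoly k[n]} (mseries n k) mseries_of mseries_of_zmod.
HB.instance Definition _ :=
  GRing.isMonoidMorphism.Build {mpoly k[n]} (mseries n k) mseries_of mseries_of_monoid.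

Lemma sord_ge_mseries_ofX a : sord_ge (mdeg a) (mseries_of 'X_[a]).
Proof.
by split=> b ba; rewrite /mseries_of mcoeffX; case: eqP ba => // ->; rewrite ltnn.
Qed.

Lemma mseries_ofC c : mseries_of c%:MP = algmap c.
Proof.
apply: funext => a; rewrite /mseries_of mcoeffC -[RHS]/(@mseriesC n k c a) /mseriesC.
by case: eqP; rewrite ?mulr1 ?mulr0.
Qed.

Lemma mseriesCM c s a : (algmap c * s) a = c * s a.
Proof.
rewrite -[LHS]/(mseriesM (mseriesC c) s a).
rewrite (@mseriesM_mcoeff _ _ _ _ c%:MP (mseries_trunc (mdeg a).+1 s)).
- by rewrite mcoeffCM mcoeff_trunc.
- by move=> b _; rewrite -[RHS]/((algmap c : mseries n k) b) -mseries_ofC.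
- by move=> b ba; rewrite mcoeff_trunc.
Qed.

(** The linear term has order at least i + m, so the error is one order better. Evaluating the
    derivative at y makes the linear term independent of x. *)
Lemma sord_ge_pow_pert x y a i m : (0 < m)%N ->
    sord_ge 1 y -> sord_ge 2 (x - y) -> sord_ge m.+1 a ->
  sord_ge (i + m.+1) ((x + a) ^+ i - x ^+ i - (y ^+ i.-1 * a) *+ i).
Proof.
move=> m_gt0 y1 xy am.
have x1 : sord_ge 1 x by rewrite -[x](subrK y); apply/sord_geD/y1/sord_ge_le/xy.
have a1 : sord_ge 1 a by apply: sord_ge_le am.
have pow_pert j : sord_ge j.+1 (x ^+ j - y ^+ j).
  elim: j => [|j IHj]; first by rewrite !expr0 subrr; apply: sord_ge_zero.
  rewrite subr_exprS.
  apply: sord_geD; first by apply: (sord_geM _ x1 IHj).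
  by apply: (sord_geM _ xy (sord_geX j y1)); rewrite muln1.
elim: i => [|i IHi]; first by rewrite !expr0 mulr0n subrr subr0; apply: sord_ge_zero.
rewrite taylor_step; apply: sord_geD; first apply: sord_geD.
- by apply: (sord_geM _ (sord_geD x1 a1) IHi); rewrite addSn add1n.
- by apply: (sord_geM _ am (pow_pert i)); rewrite addnC addnS addSn.
case: i {IHi} => [|i]; first by rewrite mulr0n mulr0; apply: sord_ge_zero.
have a2 : sord_ge 2 a by apply: sord_ge_le am.
apply: (sord_geM _ (sord_geD xy a2)) => //; last first.
  by apply/sord_geMn/(sord_geM (leqnn _) _ am)/(sord_geX i y1).
by rewrite muln1.
Qed.

Lemma sord_ge_pow_sub x y i :
  sord_ge 1 y -> sord_ge 2 (x - y) -> sord_ge i.+1 (x ^+ i - y ^+ i).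
Proof.
move=> y1 xy.
(* Here x is regarded as the perturbation of y by x - y, with m = 1. *)
have := @sord_ge_pow_pert y y (x - y) i 1 isT y1; rewrite subrr [y + _]addrC subrK.
move=> /(_ (@sord_ge_zero _) xy) H.
rewrite -[x ^+ i - _](subrK ((y ^+ i.-1 * (x - y)) *+ i)).
apply: sord_geD; first by apply: sord_ge_le H; rewrite addn2.
case: i {H} => [|i]; first by rewrite mulr0n; apply: sord_ge_zero.
by apply/sord_geMn/(sord_geM _ (sord_geX i y1) xy); rewrite muln1 addn2.
Qed.

End SeriesOrder.

(** * The functional dual to f and the annihilator of f *)

Section ApolarForm.

Local Open Scope ring_scope.

Variables (n : nat) (k : fieldType).

Implicit Types (s t : mseries n k) (f : dpoly n k).

Definition apolar_form f s : k := coeff 0%MM (contract s f).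

Lemma apolar_formE f s : apolar_form f s = \sum_(b <- dom f) coeff b f * s b.
Proof.
rewrite /apolar_form coeff_contract; apply: eq_big => [b|b _];
  first by apply/mnm_lepP => i; rewrite mnm0E.
by rewrite subm0.
Qed.

Fact apolar_form_zmod f : zmod_morphism (apolar_form f).
Proof. by move=> s t; rewrite /apolar_form contractBl coeffB. Qed.

HB.instance Definition _ f :=
  GRing.isZmodMorphism.Build (mseries n k) k (apolar_form f) (apolar_form_zmod f).

Lemma apolar_formZ f c s : apolar_form f (algmap c * s) = c * apolar_form f s.
Proof.
rewrite !apolar_formE mulr_sumr; apply: eq_bigr => b _.
by rewrite mseriesCM mulrCA.
Qed.

Lemma apolar_form_eq0 d f s : dpoly_le d f -> sord_ge d.+1 s -> apolar_form f s = 0.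
Proof.
by move=> fd [ds]; rewrite /apolar_form (contract_eq0 fd) ?coeff0.
Qed.

Lemma apolar_formX f a : apolar_form f (mseries_of 'X_[a]) = coeff a f.
Proof.
rewrite apolar_formE; under eq_bigr => b _ do rewrite /mseries_of mcoeffX mulr_natr.
have [af|af] := boolP (a \in dom f); last first.
  rewrite (coeff_outdom af) big1_seq // => b /andP[_ bf].
  by case: eqP bf af => // ->->.
rewrite (bigD1_seq a) ?uniq_dom //= eqxx big1 ?addr0 // => b.
by rewrite eq_sym => /negbTE ->.
Qed.

(** Taking for t the monomial of exponent c recovers the coefficient of index c of s acting on f.
    Hence [Ann f] is the largest ideal on which the functional vanishes. *)
Lemma AnnP f s : reflect (forall t, apolar_form f (t * s) = 0) (s \in Ann f).
Proof.
apply: (iffP idP) => [sf t|sf].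
  have := Ann_mull t sf; rewrite unfold_in => /eqP ts.
  by rewrite /apolar_form ts coeff0.
rewrite unfold_in; apply/eqP/dpolyP => c; rewrite coeff0.
by rewrite -apolar_formX /apolar_form -contractM; apply: sf.
Qed.

End ApolarForm.

(** * Successive homogenization of the functional of a quintic in two variables *)

Definition mnm2 (i j : nat) : 'X_{1..2} := (U_(ord0) *+ i + U_(ord_max) *+ j)%MM.

Lemma mdeg_mnm2 i j : mdeg (mnm2 i j) = i + j.
Proof. by rewrite mdegD !mdegMn !mdeg1 !mul1n. Qed.

Section Homogenization.

Local Open Scope ring_scope.

Variables (k : fieldType) (f : dpoly 2 k).
Hypothesis f5 : dpoly_le 5 f.

Local Notation S := (mseries 2 k).
Local Notation form := (apolar_form f).

Let al : S := mseries_of 'X_ord0.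
Let be : S := mseries_of 'X_ord_max.

Let al1 : sord_ge 1 al.
Proof. by have := @sord_ge_mseries_ofX 2 k U_(ord0); rewrite mdeg1. Qed.
Let be1 : sord_ge 1 be.
Proof. by have := @sord_ge_mseries_ofX 2 k U_(ord_max); rewrite mdeg1. Qed.

Lemma mseries_of_mnm2 i j : al ^+ i * be ^+ j = mseries_of 'X_[mnm2 i j].
Proof. by rewrite mpolyXD -!mpolyXn rmorphM !rmorphXn. Qed.

Definition quintic_coef i : k := coeff (mnm2 i (5 - i)) f.

Lemma form_monomial i j : (i + j)%N = 5%N -> form (al ^+ i * be ^+ j) = quintic_coef i.
Proof. by move=> ij; rewrite mseries_of_mnm2 apolar_formX /quintic_coef -ij addKn. Qed.

(* Rows: the unknown coefficients of the correction of degree 5 - d, the first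
   2d - 5 of them for the change of alpha_1 and the others for the change of the
   unit.  Columns: the monomials alpha_1^i alpha_2^(d-i). *)
Definition correction_mx (R : comNzRingType) (A : nat -> R) d : 'M[R]_d.+1 :=
  \matrix_(r, i) if (r < d.*2 - 5)%N then A (i.+1 - r)%N *+ i
                 else A (i + (maxn d (5 - d) - r))%N.

(** In the linear effect of the correction, u may be replaced by 1 and x by alpha_1, at the cost of
    one further order. With m = 5 - d and i + j = d the error has order 6, beyond the degree of
    f. *)
Lemma sord_ge_correction u x a c i j m : (0 < m)%N ->
    sord_ge 1 (u - 1) -> sord_ge 2 (x - al) -> sord_ge m.+1 a -> sord_ge m c ->
  sord_ge (i + j + m.+1) ((u + c) * (x + a) ^+ i * be ^+ j - u * x ^+ i * be ^+ j
     - ((al ^+ i.-1 * a) *+ i * be ^+ j + c * (al ^+ i * be ^+ j))).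
Proof.
move=> m0 u1 xal am cm; set P := (al ^+ i.-1 * a) *+ i; set Q := (x + a) ^+ i.
(* The three summands are the Taylor error of [(x + a) ^+ i], the error of replacing u + c by 1, and
   the error of replacing x by alpha_1 beside c. *)
have -> : (u + c) * Q * be ^+ j - u * x ^+ i * be ^+ j -
    (P * be ^+ j + c * (al ^+ i * be ^+ j)) =
  (u + c) * ((Q - x ^+ i - P) * be ^+ j) + (u - 1 + c) * (P * be ^+ j)
  + c * ((x ^+ i - al ^+ i) * be ^+ j).
  by move: (be ^+ j) (x ^+ i) (al ^+ i) => b y z; clear; ring.
have bej := sord_geX j be1; rewrite muln1 in bej.
have c1 : sord_ge 1 c by apply: sord_ge_le cm.
have Pm : sord_ge (i + m) P.
  rewrite /P; case: (i) => [|i']; first by rewrite mulr0n; apply: sord_ge_zero.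
  by apply/sord_geMn/(sord_geM _ (sord_geX i' al1) am); rewrite muln1 addnS addSn.
apply: sord_geD; first apply: sord_geD.
- apply: (sord_geM _ (sord_ge0 _));
    last exact: (sord_geM (leqnn _) (sord_ge_pow_pert i m0 al1 xal am) bej).
  by rewrite add0n addnAC.
- apply: (sord_geM _ (sord_geD u1 c1)); last exact: (sord_geM (leqnn _) Pm bej).
  by rewrite add1n addnAC addnS.
- apply: (sord_geM _ cm); last exact: (sord_geM (leqnn _) (sord_ge_pow_sub i al1 xal) bej).
  by rewrite addnS [(m + _)%N]addnC !addSn.
Qed.

Lemma sord_ge_correction0 a c i j m :
    sord_ge m.+1 a -> sord_ge m c ->
  sord_ge (i + j + m) ((al ^+ i.-1 * a) *+ i * be ^+ j + c * (al ^+ i * be ^+ j)).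
Proof.
move=> am cm.
have bej := sord_geX j be1; rewrite muln1 in bej.
have ali := sord_geX i al1; rewrite muln1 in ali.
apply: sord_geD; last first.
  by apply: (sord_geM _ cm (sord_geM (leqnn _) ali bej)); rewrite addnC.
case: i {ali} => [|i]; first by rewrite mulr0n mul0r; apply: sord_ge_zero.
apply: (sord_geM _ (sord_geMn _ (sord_geM (leqnn _) (sord_geX i al1) am)) bej).
by rewrite muln1 addnS !addSn addnAC.
Qed.

Definition homogeneous_from d (u x : S) : Prop := forall i j, (d <= i + j < 5)%N ->
  form (u * x ^+ i * be ^+ j) = 0.

(** The values in degree d are cancelled by solving the linear system for the correction; in degrees
    above d the correction changes the products only in order at least 6, where the functional
    vanishes. *)
Lemma homogenize_step d u x : (d < 5)%N -> \det (correction_mx quintic_coef d) != 0 ->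
    sord_ge 1 (u - 1) -> sord_ge 2 (x - al) -> homogeneous_from d.+1 u x ->
  exists u' x', [/\ sord_ge 1 (u' - 1), sord_ge 2 (x' - al) & homogeneous_from d u' x'].
Proof.
move=> d5 detM u1 xal hux; set M := correction_mx _ d in detM.
(* Exponent of alpha_1 in the unit monomial of row r. For d >= 3 these rows run through all
   monomials of degree 5 - d, for d <= 2 through the d + 1 ones with the highest powers of
   alpha_1. *)
pose e (r : 'I_d.+1) := (maxn d (5 - d) - r)%N.
pose w : 'rV[k]_d.+1 := \row_i - form (u * x ^+ i * be ^+ (d - i)).
have [v vM] : exists v, v *m M = w.
  by exists (w *m invmx M); rewrite mulmxKV // unitmxE unitfE.
pose m := (5 - d)%N; pose T (r : 'I_d.+1) := (r < d.*2 - 5)%N.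
have m0 : (0 < m)%N by rewrite subn_gt0.
(* The sum is empty for d <= 2; it involves only alpha_1^2 alpha_2 for d = 3, and all three
   quadratic monomials for d = 4. *)
pose a : S := \sum_(r | T r) algmap (v 0 r) * (al ^+ (2 - r) * be ^+ (4 - d + r)).
pose c : S := \sum_(r | ~~ T r) algmap (v 0 r) * (al ^+ e r * be ^+ (m - e r)).
have Ta (r : 'I_d.+1) : T r -> (2 - r + (4 - d + r) = m.+1)%N.
  by rewrite /T /m; lia.
have Tc (r : 'I_d.+1) : ~~ T r -> (e r + (m - e r) = m)%N.
  by rewrite /T /m /e; have := ltn_ord r; lia.
have am : sord_ge m.+1 a.
  apply: sord_ge_sum => r /Ta rm; apply: sord_geMl.
  rewrite -rm; have := sord_geM (leqnn _) (sord_geX (2 - r) al1) (sord_geX (4 - d + r) be1).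
  by rewrite !muln1.
have cm : sord_ge m c.
  apply: sord_ge_sum => r /Tc rm; apply: sord_geMl.
  rewrite -[X in sord_ge X]rm.
  have := sord_geM (leqnn _) (sord_geX (e r) al1) (sord_geX (m - e r) be1).
  by rewrite !muln1.
have main (i : 'I_d.+1) : form ((al ^+ i.-1 * a) *+ i * be ^+ (d - i)
    + c * (al ^+ i * be ^+ (d - i))) = - form (u * x ^+ i * be ^+ (d - i)).
  transitivity ((v *m M) 0 i); last by rewrite vM mxE.
  rewrite mxE (bigID T) /= raddfD /=; congr (_ + _).
    rewrite mulr_sumr -sumrMnl mulr_suml raddf_sum; apply: eq_bigr => r Tr /=.
    rewrite [M r i]mxE -/(T r) Tr.
    have -> : (al ^+ i.-1 * (algmap (v 0 r) * (al ^+ (2 - r) * be ^+ (4 - d + r)))) *+ i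
        * be ^+ (d - i) = algmap (v 0 r)
          * ((al ^+ (i.-1 + (2 - r)) * be ^+ (4 - d + r + (d - i))) *+ i).
      by rewrite !exprD mulrnAl mulrnAr; congr (_ *+ _); ring.
    rewrite apolar_formZ raddfMn /=; congr (_ * _).
    (* For i = 0 both sides have multiplicity 0, so the truncation of [i.-1] does not matter. *)
    have [->|i0] := posnP i; first by rewrite !mulr0n.
    rewrite form_monomial; last by move: Tr (ltn_ord i); rewrite /T; lia.
    by congr (quintic_coef _ *+ _); move: Tr (ltn_ord i); rewrite /T; lia.
  rewrite mulr_suml raddf_sum; apply: eq_bigr => r Tr /=.
  rewrite [M r i]mxE -/(T r) (negbTE Tr).
  have -> : algmap (v 0 r) * (al ^+ e r * be ^+ (m - e r)) * (al ^+ i * be ^+ (d - i))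
     = algmap (v 0 r) * (al ^+ (i + e r) * be ^+ (m - e r + (d - i))).
    by rewrite !exprD; ring.
  rewrite apolar_formZ form_monomial //.
  by have := Tc _ Tr; have := ltn_ord i; rewrite /m; lia.
exists (u + c), (x + a); split.
- by rewrite addrAC; apply/sord_geD/(sord_ge_le m0 cm).
- by rewrite addrAC; apply: sord_geD => //; apply: sord_ge_le am.
move=> i j /andP[dij ij5].
have pert := sord_ge_correction i j m0 u1 xal am cm.
have lt6 : (6 <= i + j + m.+1)%N by rewrite /m; lia.
have /eqP := apolar_form_eq0 f5 (sord_ge_le lt6 pert).
rewrite raddfB raddfB /= subr_eq0 subr_eq => /eqP ->.
(* Above degree d the linear term already has order at least 6; in degree d it is the value
   prescribed by the system. *)
have [dlt|dge] := ltnP d (i + j).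
  rewrite hux ?dlt // addr0 (apolar_form_eq0 f5) //.
  by apply: sord_ge_le (sord_ge_correction0 i j am cm); rewrite /m; lia.
have id : (i < d.+1)%N by lia.
have -> : j = (d - Ordinal id)%N by rewrite /=; lia.
by rewrite -[i]/(val (Ordinal id)) main addNr.
Qed.


Lemma homogenize :
    (forall d, (d < 5)%N -> \det (correction_mx quintic_coef d) != 0) ->
  exists u x, [/\ sord_ge 1 (u - 1), sord_ge 2 (x - al) & homogeneous_from 0 u x].
Proof.
move=> detM.
(* The induction descends from degree 5, where u = 1 and x = alpha_1 satisfy an empty condition. *)
suff H d : (d <= 5)%N -> exists u x,
    [/\ sord_ge 1 (u - 1), sord_ge 2 (x - al) & homogeneous_from (5 - d) u x].
  exact: (H 5%N).
elim: d => [_|d IHd d5].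
  exists 1, al; rewrite !subrr; split; try exact: sord_ge_zero.
  by move=> i j; lia.
have [u [x [u1 xal hux]]] := IHd (ltnW d5).
apply: homogenize_step u1 xal _; [lia | by apply: detM; lia |].
by rewrite subnSK.
Qed.

End Homogenization.

(** * Substitution of coordinates tangent to the standard ones *)

Section PolynomialSubstitution.

Local Open Scope ring_scope.

Variables (n : nat) (k : comNzRingType) (h : 'I_n -> mseries n k).
Hypothesis h_sub : forall i, sord_ge 2 (h i - mseries_of 'X_i).

Local Notation S := (mseries n k).
Local Notation subst := (mmap (@algmap k S) h).

Implicit Types (p q : {mpoly k[n]}) (s t u : S).

Lemma sord_ge_substX a : sord_ge (mdeg a).+1 (subst 'X_[a] - mseries_of 'X_[a]).
Proof.
(* Agreement to leading order d is multiplicative, so it passes from the variables to monomials. *)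
pose P s t d := sord_ge d t /\ sord_ge d.+1 (s - t).
suff [] : P (subst 'X_[a]) (mseries_of 'X_[a]) (mdeg a) by [].
rewrite mmapX mpolyXE_id rmorph_prod mdegE.
apply: (big_ind3 P) => [|s1 t1 c s2 t2 d [tc sc] [td sd]|i _].
- by split; [exact: sord_ge0 | rewrite subrr; exact: sord_ge_zero].
- split; first exact: (sord_geM (leqnn _) tc td).
  have -> : s1 * s2 - t1 * t2 = s2 * (s1 - t1) + t1 * (s2 - t2) by ring.
  apply: sord_geD; last by apply: (sord_geM _ tc sd); rewrite addnS.
  have s2d : sord_ge d s2.
    by rewrite -[s2](subrK t2); apply: sord_geD td; apply: sord_ge_le sd.
  by apply: (sord_geM _ s2d sc); rewrite addnS addnC.
- rewrite rmorphXn.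
  have X1 : sord_ge 1 (mseries_of 'X_i : S).
    by have := @sord_ge_mseries_ofX n k U_(i); rewrite mdeg1.
  split; last exact: sord_ge_pow_sub.
  by have := sord_geX (a i) X1; rewrite muln1.
Qed.

Lemma substE p : subst p = \sum_(a <- msupp p) algmap p@_a * subst 'X_[a].
Proof. by rewrite {1}/mmap; apply: eq_bigr => a _; rewrite mmapX. Qed.

Lemma mseries_ofE p : mseries_of p = \sum_(a <- msupp p) algmap p@_a * mseries_of 'X_[a].
Proof.
rewrite {1}[p]mpolyE rmorph_sum; apply: eq_bigr => a _.
by rewrite -mul_mpolyC rmorphM /= mseries_ofC.
Qed.

Lemma sord_ge_mseries_of d p : mord_ge d p -> sord_ge d (mseries_of p).
Proof. by move=> dp; split=> a; apply: dp. Qed.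

Lemma sord_ge_subst_sub d p : mord_ge d p -> sord_ge d.+1 (subst p - mseries_of p).
Proof.
move=> dp; rewrite substE mseries_ofE -sumrB; apply: sord_ge_sum => a _.
rewrite -mulrBr; have [ad|da] := ltnP (mdeg a) d.
  by rewrite dp // rmorph0 mul0r; apply: sord_ge_zero.
by apply/sord_geMl/sord_ge_le/sord_ge_substX.
Qed.

Lemma sord_ge_subst d p : mord_ge d p -> sord_ge d (subst p).
Proof.
move=> dp; rewrite -[subst p](subrK (mseries_of p)).
by apply/sord_geD/sord_ge_mseries_of => //; apply/sord_ge_le/sord_ge_subst_sub.
Qed.

Lemma subst_coef0 p : subst p 0%MM = p@_0.
Proof.
have H : mord_ge 0 p by [].
have [/(_ 0%MM)] := sord_ge_subst_sub H; rewrite mdeg0 => /(_ isT) /eqP.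
by rewrite -[X in X == _]/(subst p 0%MM - p@_0) subr_eq0 => /eqP.
Qed.

(** Successive approximation: a remainder of order N is corrected by its part of degree N, which u
    and the substitution change only in order N + 1. *)
Lemma subst_approx u N s : sord_ge 1 (u - 1) ->
  exists p, sord_ge N (s - u * subst p).
Proof.
move=> u1; elim: N => [|N [p]]; first by exists 0; apply: sord_ge0.
set s' := s - _ => Ns'; pose q := mseries_trunc N.+1 s'.
have Nq : mord_ge N q.
  by move=> a aN; rewrite mcoeff_trunc ?(leqW aN) //; case: Ns' => ->.
exists (p + q).
have -> : s - u * subst (p + q) = (s' - mseries_of q) - (subst q - mseries_of q)
    - (u - 1) * subst q by rewrite rmorphD /= /s'; ring.
apply: sord_geB; last by apply: (sord_geM _ u1 (sord_ge_subst Nq)).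
apply: sord_geB (sord_ge_subst_sub Nq); split=> a aN.
by rewrite -[LHS]/(s' a - q@_a) mcoeff_trunc // subrr.
Qed.

End PolynomialSubstitution.

(** * A homogeneous functional yields a homogeneous presentation of the apolar algebra *)

Lemma eval_pihomog (n : nat) (k : comNzRingType) (L : {mpoly k[n]} -> k) d :
    (forall p q, L (p + q) = L p + L q)%R -> (forall c p, L (c *: p) = c * L p)%R ->
    (forall a, mdeg a != d -> L 'X_[a] = 0)%R ->
  forall p, L p = L (pihomog mdeg d p).
Proof.
move=> LD LZ LX.
have L0 : L 0%R = 0%R by rewrite -(scale0r 0%R) LZ mul0r.
elim/mpolyind => [|c a p _ _ IHp]; first by rewrite pihomog0.
rewrite pihomogD !LD IHp linearZ /= !LZ pihomogX; congr (_ + _)%R.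
by case: eqP => // /eqP /LX ->; rewrite L0.
Qed.

Section HomogeneousDual.

Local Open Scope ring_scope.

Variables (n : nat) (k : fieldType) (d : nat) (f : dpoly n k).
Variables (h : 'I_n -> mseries n k) (u : mseries n k).

Local Notation S := (mseries n k).
Local Notation subst := (mmap (@algmap k S) h).
Local Notation form := (apolar_form f).

Hypothesis f_neq0 : f != 0.
Hypothesis f_le : dpoly_le d f.
Hypothesis h_sub : forall i, sord_ge 2 (h i - mseries_of 'X_i).
Hypothesis u_unit : sord_ge 1 (u - 1).
Hypothesis form_homog : forall a, (mdeg a < d)%N -> form (u * subst 'X_[a]) = 0.

Implicit Types (p q : {mpoly k[n]}).

Lemma form_substD p q :
  form (u * subst (p + q)) = form (u * subst p) + form (u * subst q).
Proof. by rewrite mmapD mulrDr raddfD. Qed.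

Lemma form_substZ c p : form (u * subst (c *: p)) = c * form (u * subst p).
Proof. by rewrite -mul_mpolyC rmorphM /= mmapC mulrCA apolar_formZ. Qed.

Lemma form_substX_eq0 a : mdeg a != d -> form (u * subst 'X_[a]) = 0.
Proof.
rewrite neq_ltn => /orP[/form_homog // | gt].
have aa : mord_ge (mdeg a) ('X_[a] : {mpoly k[n]}).
  by move=> b; rewrite mcoeffX; case: eqP => // ->; rewrite ltnn.
apply: (apolar_form_eq0 f_le).
by apply/sord_geMl/(sord_ge_le gt)/sord_ge_subst.
Qed.

Lemma form_pihomog p : form (u * subst p) = form (u * subst (pihomog mdeg d p)).
Proof.
exact: (eval_pihomog form_substD form_substZ form_substX_eq0 p).
Qed.

Lemma pihomogMX a p :
  pihomog mdeg d ('X_[a] * p) =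
  if (mdeg a <= d)%N then 'X_[a] * pihomog mdeg (d - mdeg a) p else 0.
Proof.
rewrite pihomogM; under eq_bigr => i _ do rewrite pihomogX.
case: leqP => ad.
  rewrite (bigD1 (Ordinal (ltnSE (leq_trans ad (leqnn _)) : (mdeg a < d.+1)%N))) //=.
  rewrite eqxx big1 ?addr0 // => i.
  by rewrite -val_eqE /= eq_sym => /negbTE ->; rewrite mul0r.
by rewrite big1 // => i _; rewrite gtn_eqF ?mul0r // (leq_trans (ltn_ord i)).
Qed.

(** Paired with a monomial of exponent b, the functional sees only degree d. There the part of
    degree e of p contributes only if [mdeg b] + e = d, and then exactly as p itself does, namely by
    0. *)
Fact subst_ker_pihomog p e :
  subst p \in Ann f -> subst (pihomog mdeg e p) \in Ann f.
Proof.
move=> /AnnP pf; apply/AnnP => t; set r := pihomog mdeg e p.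
(* Modulo order d + 1, invisible to the functional, every test series is u times a polynomial in
   h. *)
have [q tq] := subst_approx h_sub d.+1 t u_unit.
rewrite -[t](subrK (u * subst q)) mulrDl raddfD /=.
rewrite (apolar_form_eq0 f_le) ?add0r; last by rewrite mulrC; apply: sord_geMl.
rewrite mulrAC (substE h q) mulr_sumr raddf_sum big1 // => b _ /=.
have -> : u * subst r * (algmap q@_b * subst 'X_[b]) =
    algmap q@_b * (u * subst ('X_[b] * r)) by rewrite rmorphM /=; ring.
rewrite apolar_formZ form_pihomog pihomogMX.
case: leqP => bd; last by rewrite rmorph0 mulr0 raddf0 mulr0.
have -> : pihomog mdeg (d - mdeg b) r = if (d - mdeg b)%N == e then r else 0.
  apply/mpolyP => a; rewrite (fun_if (mcoeff a)) !mcoeff_pihomog mcoeff0.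
  by case: (d - mdeg b =P e)%N => [->|de]; case: eqP => // ->; case: eqP.
case: eqP => [db|_]; last by rewrite mulr0 rmorph0 mulr0 raddf0 mulr0.
have -> : 'X_[b] * r = pihomog mdeg d ('X_[b] * p) by rewrite pihomogMX bd db.
by rewrite -form_pihomog rmorphM /= mulrA pf mulr0.
Qed.

(* In the coordinates h the functional s |-> apolar_form f (u s) is homogeneous
   of degree d, and so is its largest ideal of zeros, the kernel of subst. *)
Lemma canonically_graded_of_form : canonically_graded f.
Proof.
pose psi : {rmorphism {mpoly k[n]} -> Apolar f} :=
  GRing.RMorphism.clone _ _ (apolar_cls f \o subst) _.
have psi_eq0 p : psi p = 0 <-> subst p \in Ann f.
  by rewrite -(rmorph0 (apolar_cls f)) -[X in X \in _]subr0; apply: apolar_clsP.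
apply: (@alg_isomorphic_gr _ _ _ _ psi) => [c|a|p|p e].
- by rewrite /= mmapC.
- elim/apolar_cls_ind: a => s; have one : sord_ge 1 (1 - 1 : S).
    by rewrite subrr; apply: sord_ge_zero.
  have [p sp] := subst_approx h_sub d.+1 s one; exists p.
  apply/apolar_clsP/AnnP => t; apply: (apolar_form_eq0 f_le).
  by rewrite -opprB mulrN -mulNr; apply: sord_geMl; rewrite mul1r in sp.
- by rewrite -(subst_coef0 h_sub); apply: max_ideal_apolar.
- by rewrite !psi_eq0; apply: subst_ker_pihomog.
Qed.

End HomogeneousDual.

(** * The discriminant polynomial and a quintic where it does not vanish *)

Section GeneralQuintic.

Local Open Scope ring_scope.

Variable k : fieldType.

Implicit Types f : dpoly 2 k.

Lemma canonically_graded_quintic f : dpoly_le 5 f -> f != 0 ->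
    (forall d, (d < 5)%N -> \det (correction_mx (quintic_coef f) d) != 0) ->
  canonically_graded f.
Proof.
move=> f5 f0 /(homogenize f5)[u [x [u1 x2 hux]]].
pose h (i : 'I_2) : mseries 2 k := if i == ord0 then x else mseries_of 'X_i.
apply: (@canonically_graded_of_form _ _ 5 f h u) => // [i|a a5].
  by rewrite /h; case: eqP => [->//|_]; rewrite subrr; apply: sord_ge_zero.
rewrite mmapX /mmap1 big_ord_recl big_ord1 /h /= mulrA.
have e : fintype.lift ord0 ord0 = ord_max :> 'I_2 by apply: val_inj.
by rewrite e; apply: hux; move: a5; rewrite mdegE big_ord_recl big_ord1 e.
Qed.

Local Notation coords := #|{: 'X_{1..2 < 6}}|.

(** The default 0 is taken for i > 5, where the monomial has degree above 5 and its coefficient in f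
    vanishes too. *)
Definition quintic_coef_poly i : {mpoly k[coords]} :=
  oapp (fun b => 'X_(enum_rank b)) 0 (insub (mnm2 i (5 - i)) : option 'X_{1..2 < 6}).

Lemma quintic_coef_polyE f i : dpoly_le 5 f ->
  (quintic_coef_poly i).@[dpoly_coords 5 f] = quintic_coef f i.
Proof.
move=> f5; rewrite /quintic_coef_poly /quintic_coef.
case: insubP => [b _ <-|i6] /=; first by rewrite mevalXU /dpoly_coords enum_rankK.
rewrite meval0; apply/esym/eqP; apply: contraNT i6 => /f5.
by rewrite -ltnS.
Qed.

Definition discr_poly : {mpoly k[coords]} :=
  \prod_(d < 5) \det (correction_mx quintic_coef_poly d).

Lemma discr_polyE f : dpoly_le 5 f ->
  discr_poly.@[dpoly_coords 5 f] =
  \prod_(d < 5) \det (correction_mx (quintic_coef f) d).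
Proof.
move=> f5; rewrite rmorph_prod; apply: eq_bigr => d _.
rewrite -det_map_mx; congr (\det _); apply/matrixP => r i; rewrite !mxE.
by case: ifP => _; rewrite ?rmorphMn /= quintic_coef_polyE.
Qed.

(** Row vectors are given as sequences over [nat], so that small systems expand into equations in
    [y 0], [y 1] and so on. *)
Lemma det_neq0 (R : fieldType) m (M : 'M[R]_m.+1) :
    (forall y : nat -> R, (forall i : 'I_m.+1, \sum_(r < m.+1) y r * M r i = 0) ->
       forall r, (r < m.+1)%N -> y r = 0) ->
  \det M != 0.
Proof.
move=> inj; rewrite -unitfE -unitmxE -row_free_unit; apply: inj_row_free => v vM.
apply/rowP => r; rewrite mxE; pose y i := v 0 (inord i).
rewrite -[r]inord_val -/(y r) inj // => i; move/rowP/(_ i): vM; rewrite !mxE => vMi.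
by rewrite -[RHS]vMi; apply: eq_bigr => s _; rewrite /y inord_val.
Qed.

Definition sample_quintic : dpoly 2 k :=
  << mnm2 1 4 >> + << mnm2 4 1 >> + << mnm2 5 0 >>.

Lemma mnm2_inj i j i' j' : (mnm2 i j == mnm2 i' j') = (i == i') && (j == j').
Proof.
apply/eqP/andP => [e|[/eqP-> /eqP->]//].
by split; apply/eqP; [move/mnmP/(_ ord0): e | move/mnmP/(_ ord_max): e];
   rewrite !(mnmE, mulmnE, mnm1E) /= !(mul0n, mul1n, addn0, add0n).
Qed.

Lemma sample_quintic_le : dpoly_le 5 sample_quintic.
Proof.
move=> a; rewrite !coeffD !coeffU !mul1r.
have [<-|_] := eqVneq (mnm2 1 4) a; first by rewrite mdeg_mnm2.
have [<-|_] := eqVneq (mnm2 4 1) a; first by rewrite mdeg_mnm2.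
have [<-|_] := eqVneq (mnm2 5 0) a; first by rewrite mdeg_mnm2.
by rewrite !addr0 eqxx.
Qed.

Lemma sample_quinticE i :
  quintic_coef sample_quintic i = ((i == 1) || (i == 4) || (i == 5))%N%:R.
Proof.
rewrite /quintic_coef !coeffD !coeffU !mul1r !mnm2_inj.
case: i => [|[|[|[|[|[|i]]]]]] //=; rewrite ?addr0 ?add0r //.
Qed.

Local Ltac column yM i e :=
  have e := yM i isT; rewrite !big_ord_recr big_ord0 /= in e;
  rewrite ?(mulr0n, mulr1n, mulr0, mulr1, add0r, addr0, mul0rn) in e.

(** For d = 0, ..., 4 the determinants are, up to sign, 1, 1, 1, 3 and 18; the systems are solved
    column by column. *)
Lemma sample_quintic_discr d : 2%:R != 0 :> k -> 3%:R != 0 :> k -> (d < 5)%N ->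
  \det (correction_mx (quintic_coef sample_quintic) d) != 0.
Proof.
move=> k2 k3 d5; apply: det_neq0 => y yM.
have {}yM i : (i < d.+1)%N -> \sum_(r < d.+1) y r *
    (if (r < d.*2 - 5)%N then ((i.+1 - r == 1) || (i.+1 - r == 4) || (i.+1 - r == 5))%N%:R *+ i
     else ((i + (maxn d (5 - d) - r) == 1) || (i + (maxn d (5 - d) - r) == 4)
       || (i + (maxn d (5 - d) - r) == 5))%N%:R) = 0.
  move=> id; rewrite -[RHS](yM (Ordinal id)); apply: eq_bigr => r _.
  by rewrite mxE !sample_quinticE.
case: d d5 yM => [|[|[|[|[|//]]]]] _ yM.
all: column yM 0%N e0.
2,3,4,5: column yM 1%N e1.
3,4,5: column yM 2%N e2.
4,5: column yM 3%N e3.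
5: column yM 4%N e4.
- by case.
- by rewrite e0 add0r in e1; case=> [|[]].
- by rewrite e1 add0r in e2; case=> [|[|[]]].
- move/eqP: e3; rewrite e2 e0 !addr0 mulf_eq0 (negbTE k3) orbF => /eqP e3.
  by case=> [|[|[|[]]]].
- move/eqP: e3; rewrite e0 addr0 mulf_eq0 (negbTE k3) orbF => /eqP e3.
  move/eqP: e2; rewrite mulf_eq0 (negbTE k2) orbF => /eqP e2.
  have y1 : y 1%N = 0.
    move: e4; rewrite e3 e0 mul0r add0r addr0 => e4; apply/eqP.
    have /eqP : y 1%N * 3%:R = 0 by rewrite -[RHS](subrr 0) -{1}e4 -e1; ring.
    by rewrite mulf_eq0 (negbTE k3) orbF.
  by rewrite y1 add0r in e1; case=> [|[|[|[|[]]]]].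
Qed.


End GeneralQuintic.

Theorem mainTheorem3 (k : closedFieldType)
    (char_k : [pchar k]%R =i pred0 \/ exists2 p, p \in [pchar k]%R & 5 < p) :
  exists U : dpoly 2 k -> Prop,
    [/\ zariski_open 5 U,
        exists f, U f
      & forall f, U f -> dpoly_degree 5 f /\ canonically_graded f].
Proof.
have prime_neq0 q : prime q -> q < 5 -> (q%:R != 0 :> k)%R.
  move=> q_pr q5; apply/negP => q0; have qk : q \in [pchar k]%R by apply/andP.
  case: char_k => [/(_ q)|[p pk p5]]; first by rewrite qk.
  by move: qk p5; rewrite (pcharf_eq pk) inE => /eqP <-; rewrite ltnNge ltnW.
exists (fun f => dpoly_le 5 f /\ (discr_poly k).@[dpoly_coords 5 f] != 0%R); split.
- split=> [f [] //|]; exists (fun p => p = discr_poly k) => f f5.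
  by split=> [[_ fU]|[p -> fU]] //; exists (discr_poly k).
- exists (sample_quintic k); have s5 := @sample_quintic_le k; split=> //.
  rewrite discr_polyE //; apply/prodf_neq0 => d _.
  by apply: sample_quintic_discr; rewrite ?prime_neq0.
move=> f [f5]; rewrite discr_polyE // => /prodf_neq0 fU.
have detf d : d < 5 -> (\det (correction_mx (quintic_coef f) d) != 0)%R.
  by move=> d5; apply: (fU (Ordinal d5)).
(* The determinant for d = 0 is the coefficient of x_1^[5], so its nonvanishing forces degree
   exactly five. *)
have f50 : coeff (mnm2 5 0) f != 0%R.
  by have := detf 0 isT; rewrite det_mx11 mxE.
split; first by split=> //; exists (mnm2 5 0); rewrite mdeg_mnm2.
apply: canonically_graded_quintic => //.
by apply: contraNneq f50 => ->; rewrite coeff0.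
Qed.
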